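(* Fix a constant $a>1$. For each $n\ge1$ let $(\mathscr{X}_n,+)$ be a finite abelian group of size $N_n\ge3$, and let $d_n$ be a positive integer such that $$d_n\ge a\log_2N_n\ \text{ for all } n,\qquad\text{and}\qquad \frac{\log d_n}{(\log N_n)^{1/3}}\xrightarrow[n\to\infty]{}0 .$$ Let $G_n=\mathrm{Cay}(\mathscr{X}_n,S_n)$ be the random Cayley graph obtained by choosing $d_n$ generators $z_1,\dots,z_{d_n}$ independently and uniformly at random in $\mathscr{X}_n$, with $S_n=\{z_1,\dots,z_{d_n}\}\cup\{-z_1,\dots,-z_{d_n}\}$. Then the simple random walk on $G_n$ exhibits cutoff with high probability: the probability that $S_n$ generates $\mathscr{X}_n$ tends to $1$ as $n\to\infty$, and for every fixed $\varepsilon\in(0,1)$, the ratio $\mathrm{t}_{\mathrm{mix}}^{(n)}(1-\varepsilon)/\mathrm{t}_{\mathrm{mix}}^{(n)}(\varepsilon)$ (defined on that event) tends to $1$ in probability, where $\mathrm{t}_{\mathrm{mix}}^{(n)}$ denotes the mixing time of the simple random walk on $G_n$.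
   Context: For a finite abelian group $\mathscr{X}$ and a symmetric generating set $S\subseteq\mathscr{X}$, the simple random walk on $\mathrm{Cay}(\mathscr{X},S)$ has transition matrix $P(x,y)=\frac1{|S|}\sum_{z\in S}\mathbf{1}_{(y=x+z)}$, with invariant law $\pi$ uniform on $\mathscr{X}$. Its heat kernel is $\mathscr{P}_t(x,y)=e^{-t}\sum_{k\ge 0}\frac{P^k(x,y)t^k}{k!}$, $t\ge0$, and its mixing time is $\mathrm{t}_{\mathrm{mix}}(\varepsilon)=\min\{t\ge 0:\max_{x}\|\mathscr{P}_t(x,\cdot)-\pi\|_{\mathrm{TV}}\le\varepsilon\}$ for $\varepsilon\in(0,1)$, with $\|\mu-\pi\|_{\mathrm{TV}}=\max_{A\subseteq\mathscr{X}}|\mu(A)-\pi(A)|$. *)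

(* Defs.v *)
From HB Require Import structures.
From mathcomp Require Import all_boot all_order all_algebra all_fingroup.
From mathcomp Require Import all_classical all_reals all_analysis.

Set Implicit Arguments.
Unset Strict Implicit.
Unset Printing Implicit Defensive.

Import Order.TTheory GRing.Theory Num.Theory.
Import numFieldNormedType.Exports.

Local Open Scope classical_set_scope.
Local Open Scope ring_scope.

Section RandomWalk.
Variables (R : realType) (X : finZmodType) (S : {set X}).

Definition walk_kernel (x y : X) : R :=
  #|S|%:R^-1 * \sum_(z in S) (y == x + z)%:R.

Definition walk_matrix : 'M[R]_#|X| :=
  \matrix_(i, j) walk_kernel (enum_val i) (enum_val j).

Definition walk_power (k : nat) (x y : X) : R :=
  (walk_matrix ^+ k) (enum_rank x) (enum_rank y).

Definition heat_kernel (t : R) (x y : X) : R :=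
  expR (- t) * limn (series (fun k => walk_power k x y * t ^+ k / k`!%:R)).

Definition uniform_law : X -> R := fun=> #|X|%:R^-1.

(* The default value 0 of the maxima below is harmless: all the terms are
   nonnegative. *)
Definition tv_dist (mu nu : X -> R) : R :=
  \big[Num.max/0]_(A : {set X}) `|\sum_(y in A) mu y - \sum_(y in A) nu y|.

Definition worst_tv (t : R) : R :=
  \big[Num.max/0]_(x : X) tv_dist (heat_kernel t x) uniform_law.

(* When S generates X and 0 < e, the set below is nonempty and closed, so the
   infimum is a minimum; inf is 0 by convention on the empty set. *)
Definition mixing_time (e : R) : R :=
  inf [set t : R | 0 <= t /\ worst_tv t <= e].

(* <<S>> is the subgroup generated by S in the additive group X. *)
Definition generates : bool := <<S>>%g == [set: X]%SET.

End RandomWalk.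

Definition sym_set (X : finZmodType) (d : nat) (z : {ffun 'I_d -> X}) : {set X} :=
  ([set z i | i : 'I_d] :|: [set - z i | i : 'I_d])%SET.

(* The law of d independent uniform elements of X: the product measure. *)
Definition iid_prob (R : realType) (X : finZmodType) (d : nat)
    (E : {ffun 'I_d -> X} -> Prop) : R :=
  \sum_(z : {ffun 'I_d -> X} | `[< E z >]) \prod_(i < d) uniform_law R (z i).

(* Main.v *)
(* Write the heat kernel as [mu_t] in the convolution algebra of the group.

   Window.  If the total variation distance at time [t] is at most [1 - e], then
   by Chebyshev's inequality [ln (N mu_t)] is at most [O(1 + sqrt V)] outside an
   event of [mu_t]-probability [e / 2], where [V] is its variance under [mu_t]
   (the varentropy).  Discarding this event and using the spectral gap [c], an
   extra time [O((1 + sqrt V) / c)] brings the distance below [e].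
   Translations commute with the walk, which gives the local Poincare inequality
   [V <= t * E |grad ln mu_t|^2]; adding one step to a path shows that
   [mu_t (x + s) / mu_t x] is not much smaller than [1 / |S|], so
   [V = O(t (ln |S|)^2)].  On the other hand, counting the points reachable in [r]
   steps gives [t = Omega (ln N / ln |S|)], hence [sqrt V = o(t)] as soon as
   [(ln d)^3 = o(ln N)].

   Gap.  With [p] close to [1/2], the second moment over [z] of the law of
   [sum_i e_i z_i], with [e_i] Bernoulli([p]), is
   [1 / N + (1 - 2 p (1 - p))^d (1 - 1 / N)], so that for [d >= a log2 N] the operator
   [prod_i ((1 - p) + p tau_{z_i})] is exponentially small in [d] on mean-zero
   functions.  Convexity inequalities between commuting positive operators turn
   this into a uniform lower bound for the Dirichlet form. *)

Require Import Defs.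
From HB Require Import structures.
From mathcomp Require Import all_boot all_order all_algebra all_fingroup.
From mathcomp Require Import all_classical all_reals all_analysis.
From mathcomp Require Import ring lra zify.

Set Implicit Arguments.
Unset Strict Implicit.
Unset Printing Implicit Defensive.

Import Order.TTheory GRing.Theory Num.Theory.
Import numFieldNormedType.Exports.

Local Open Scope classical_set_scope.
Local Open Scope ring_scope.

(** * The convolution algebra of a finite abelian group *)

(** The coin parameter [p] must stay strictly below 1/2. At 1/2 the factor of a single generator can
    vanish, namely where its translation acts as -1, so the product could be small because of one
    generator and would say nothing about the sum of the Dirichlet forms. For [p] below 1/2 each
    factor is at least (1 - 2p)^2, hence dominates a fixed power of a small perturbation of the
    identity; an exponentially small product then forces a positive proportion of the generators to
    contribute. The slack [a > 1] pays for leaving 1/2: the second moment must still beat 1 / N.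

    Neither characters nor eigenvalues appear. Inequalities between commuting positive elements,
    with iterated Cauchy-Schwarz, replace the spectral theorem. The decay and the local Poincare
    inequality are proved by induction on the powers of one short step and then passed to the limit,
    which avoids differentiating the semigroup. *)

Definition group_algebra (R : realType) (X : finZmodType) := {ffun X -> R^o}.

Section GroupAlgebra.
Variables (R : realType) (X : finZmodType).
Local Notation A := (group_algebra R X).

HB.instance Definition _ := GRing.Lmodule.copy A {ffun X -> R^o}.

Definition convol (f g : A) : A := [ffun x => \sum_y f y * g (x - y)].
Definition dirac0 : A := [ffun x => (x == 0)%:R].

Lemma convolC : commutative convol.
Proof.
move=> f g; apply/ffunP => x; rewrite !ffunE.
rewrite (reindex_inj (inj_comp (addrI x) (@oppr_inj X))) /=.
by apply: eq_bigr => y _; rewrite opprB addrCA subrr addr0 mulrC.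
Qed.

Lemma convolA : associative convol.
Proof.
move=> f g h; apply/ffunP => x; rewrite !ffunE.
under eq_bigr do rewrite ffunE mulr_sumr.
under [RHS]eq_bigr do rewrite ffunE mulr_suml.
rewrite [RHS]exchange_big /=; apply: eq_bigr => y _.
rewrite [RHS](reindex_inj (addIr y)) /=; apply: eq_bigr => z _.
by rewrite addrK mulrA opprD addrA addrAC.
Qed.

Lemma convol1f : left_id dirac0 convol.
Proof.
move=> f; apply/ffunP => x; rewrite ffunE (bigD1 0) //= ffunE eqxx mul1r subr0.
by rewrite big1 ?addr0// => y /negPf y0; rewrite ffunE y0 mul0r.
Qed.

Lemma convolDl : left_distributive convol +%R.
Proof.
move=> f g h; apply/ffunP => x; rewrite !ffunE -big_split.
by apply: eq_bigr => y _; rewrite !ffunE mulrDl.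
Qed.

Lemma dirac0_neq0 : dirac0 != 0.
Proof. by apply/eqP => /ffunP /(_ 0) /eqP; rewrite !ffunE eqxx oner_eq0. Qed.

HB.instance Definition _ :=
  GRing.Zmodule_isComNzRing.Build A convolA convolC convol1f convolDl dirac0_neq0.

Lemma convolZl (a : R) (f g : A) : a *: (f * g) = (a *: f) * g.
Proof.
apply/ffunP => x; rewrite !ffunE /GRing.scale /= mulr_sumr.
by apply: eq_bigr => y _; rewrite !ffunE mulrA.
Qed.

HB.instance Definition _ := GRing.Lmodule_isLalgebra.Build R A convolZl.
HB.instance Definition _ := GRing.Lalgebra_isComAlgebra.Build R A.

Implicit Types (f g h : A) (x y s : X) (a b : R).

Lemma convE f g x : (f * g) x = \sum_y f y * g (x - y).
Proof. by rewrite ffunE. Qed.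

Lemma one_alg_coef x : (1 : A) x = (x == 0)%:R.
Proof. by rewrite ffunE. Qed.

Lemma add_alg_coef f g x : (f + g) x = f x + g x.
Proof. by rewrite ffunE. Qed.

Lemma opp_alg_coef f x : (- f) x = - f x.
Proof. by rewrite ffunE. Qed.

Lemma sub_alg_coef f g x : (f - g) x = f x - g x.
Proof. by rewrite !ffunE. Qed.

Lemma zero_alg_coef x : (0 : A) x = 0.
Proof. by rewrite ffunE. Qed.

Lemma scale_alg_coef a f x : (a *: f) x = a * f x.
Proof. by rewrite ffunE. Qed.

Lemma sum_alg_coef (I : Type) (r : seq I) (P : pred I) (F : I -> A) x :
  (\sum_(i <- r | P i) F i) x = \sum_(i <- r | P i) F i x.
Proof.
elim/big_rec2: _ => [|i u v _ <-]; first by rewrite zero_alg_coef.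
by rewrite add_alg_coef.
Qed.

Definition algE := (add_alg_coef, opp_alg_coef, zero_alg_coef,
  scale_alg_coef, one_alg_coef, sum_alg_coef).

Definition dirac_alg s : A := [ffun x => (x == s)%:R].

Lemma dirac_algM s f x : (dirac_alg s * f) x = f (x - s).
Proof.
rewrite convE (bigD1 s) //= ffunE eqxx mul1r big1 ?addr0// => y /negPf ys.
by rewrite ffunE ys mul0r.
Qed.

Lemma dirac_algD s t : dirac_alg (s + t) = dirac_alg s * dirac_alg t.
Proof.
by apply/ffunP => x; rewrite dirac_algM !ffunE subr_eq addrC.
Qed.

Lemma dirac_alg0 : dirac_alg 0 = 1.
Proof. by apply/ffunP => x; rewrite !ffunE. Qed.

Definition star f : A := [ffun x => f (- x)].

Lemma starE f x : star f x = f (- x). Proof. by rewrite ffunE. Qed.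

Lemma starK f : star (star f) = f.
Proof. by apply/ffunP => x; rewrite !ffunE opprK. Qed.

Lemma starD f g : star (f + g) = star f + star g.
Proof. by apply/ffunP => x; rewrite !ffunE. Qed.

Lemma starZ a f : star (a *: f) = a *: star f.
Proof. by apply/ffunP => x; rewrite !ffunE. Qed.

Lemma star1 : star 1 = 1.
Proof. by apply/ffunP => x; rewrite !ffunE oppr_eq0. Qed.

Lemma starB f g : star (f - g) = star f - star g.
Proof. by apply/ffunP => x; rewrite !ffunE. Qed.

Lemma star_dirac s : star (dirac_alg s) = dirac_alg (- s).
Proof. by apply/ffunP => x; rewrite !ffunE eqr_oppLR. Qed.

Lemma starM f g : star (f * g) = star f * star g.
Proof.
apply/ffunP => x; rewrite starE !convE (reindex_inj (@oppr_inj X)).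
by apply: eq_bigr => y _; rewrite !starE opprB opprK addrC.
Qed.

Lemma starX f n : star (f ^+ n) = star f ^+ n.
Proof. by elim: n => [|n IH]; rewrite ?expr0 ?star1// !exprS starM IH. Qed.

Lemma star_prod (I : Type) (r : seq I) (F : I -> A) :
  star (\prod_(i <- r) F i) = \prod_(i <- r) star (F i).
Proof. by elim/big_rec2: _ => [|i u v _ <-]; rewrite ?star1 ?starM. Qed.

Definition mass f : R := \sum_x f x.

Lemma massM f g : mass (f * g) = mass f * mass g.
Proof.
rewrite /mass mulr_suml; under eq_bigr do rewrite convE.
rewrite exchange_big /=; apply: eq_bigr => y _; rewrite -mulr_sumr.
by congr (_ * _); rewrite (reindex_inj (addIr y)) /=; under eq_bigr do rewrite addrK.
Qed.

Lemma mass1 : mass 1 = 1.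
Proof.
rewrite /mass (bigD1 0)//= one_alg_coef eqxx big1 ?addr0// => x /negPf x0.
by rewrite one_alg_coef x0.
Qed.

Lemma massD f g : mass (f + g) = mass f + mass g.
Proof. by rewrite /mass -big_split; apply: eq_bigr => x _; rewrite !algE. Qed.

Lemma massZ a f : mass (a *: f) = a * mass f.
Proof. by rewrite /mass mulr_sumr; apply: eq_bigr => x _; rewrite !algE. Qed.

Lemma massX f n : mass (f ^+ n) = mass f ^+ n.
Proof. by elim: n => [|n IH]; rewrite ?expr0 ?mass1// !exprS massM IH. Qed.

Lemma conv_ge0 f g : (forall x, 0 <= f x) -> (forall x, 0 <= g x) ->
  forall x, 0 <= (f * g) x.
Proof. by move=> f0 g0 x; rewrite convE sumr_ge0// => y _; rewrite mulr_ge0. Qed.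

Lemma exp_alg_ge0 f n : (forall x, 0 <= f x) -> forall x, 0 <= (f ^+ n) x.
Proof.
move=> f0; elim: n => [|n IH] x; first by rewrite expr0 one_alg_coef.
by rewrite exprS conv_ge0.
Qed.

Lemma coef_le_mass f x : (forall x, 0 <= f x) -> f x <= mass f.
Proof. by move=> f0; rewrite /mass (bigD1 x)//= lerDl sumr_ge0. Qed.

(** Reading the inner product as a coefficient of a product turns the adjunction [dotM] into an
    identity of the commutative ring. *)
Definition dot f g : R := (f * star g) 0.

Lemma dotE f g : dot f g = \sum_x f x * g x.
Proof.
by rewrite /dot convE; apply: eq_bigr => x _; rewrite starE sub0r opprK.
Qed.

Lemma dotDl f g h : dot (f + g) h = dot f h + dot g h.
Proof. by rewrite /dot mulrDl algE. Qed.

Lemma dotBl f g h : dot (f - g) h = dot f h - dot g h.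
Proof. by rewrite /dot mulrBl sub_alg_coef. Qed.

Lemma dotZl a f g : dot (a *: f) g = a * dot f g.
Proof. by rewrite /dot -scalerAl algE. Qed.

Lemma dotC f g : dot f g = dot g f.
Proof. by rewrite !dotE; apply: eq_bigr => x _; rewrite mulrC. Qed.

Lemma dot_subZ f g a :
  dot (f - a *: g) (f - a *: g) = dot f f - 2 * a * dot f g + a ^+ 2 * dot g g.
Proof.
rewrite dotBl dotZl ![dot _ (_ - _)]dotC !dotBl !dotZl (dotC g f); ring.
Qed.

Lemma dotM f g h : dot (f * g) h = dot g (star f * h).
Proof. by rewrite /dot starM starK mulrCA mulrA. Qed.

Lemma dot_ge0 f : 0 <= dot f f.
Proof. by rewrite dotE sumr_ge0// => x _; rewrite -expr2 sqr_ge0. Qed.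

Lemma dot_eq0 f : dot f f = 0 -> f = 0.
Proof.
rewrite dotE => /eqP; rewrite psumr_eq0 => [/allP f0|x _]; last by rewrite -expr2 sqr_ge0.
apply/ffunP => x; rewrite algE; apply/eqP; rewrite -sqrf_eq0 expr2.
by apply: f0; rewrite mem_index_enum.
Qed.

Lemma dot_CS f g : dot f g ^+ 2 <= dot f f * dot g g.
Proof.
have [g0|g0] := eqVneq (dot g g) 0.
  by rewrite (dot_eq0 g0) dotC dotE big1 ?expr0n ?mulr_ge0 ?dot_ge0// => x _; rewrite algE mul0r.
have gp : 0 < dot g g by rewrite lt_neqAle eq_sym g0 dot_ge0.
have := dot_ge0 (dot g g *: f - dot f g *: g).
rewrite dotBl !dotZl ![dot _ (_ - _)]dotC !dotBl !dotZl (dotC g f).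
set p := dot f g; set q := dot g g; set r := dot f f.
have -> : q * (q * r - p * p) - p * (q * p - p * q) = q * (r * q - p ^+ 2) by ring.
by rewrite pmulr_rge0// subr_ge0.
Qed.

(** Scalars as elements of the algebra, so that [ring] can handle identities that mix scaling and
    convolution. *)
Definition cst a : A := a *: 1.

Lemma cstE a f : a *: f = cst a * f.
Proof. by rewrite /cst -scalerAl mul1r. Qed.

Lemma cstM a b : cst (a * b) = cst a * cst b.
Proof. by rewrite -cstE /cst scalerA. Qed.

Lemma cstB a b : cst (a - b) = cst a - cst b.
Proof. exact: scalerBl. Qed.

Lemma cst1 : cst 1 = 1. Proof. exact: scale1r. Qed.

Lemma cst_nat n : cst n%:R = n%:R. Proof. exact: scaler_nat. Qed.

Lemma cstX a n : cst (a ^+ n) = cst a ^+ n.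
Proof. by elim: n => [|n IH]; rewrite ?expr0 ?cst1// !exprS cstM IH. Qed.

End GroupAlgebra.

(** * Positive cone and spectral gap *)

Section Cone.
Variables (B : comNzRingType) (P : B -> Prop).
Hypotheses (P0 : P 0) (P1 : P 1) (PD : forall x y, P x -> P y -> P (x + y))
  (PM : forall x y, P x -> P y -> P (x * y)).

Lemma cone_sum (I : Type) (r : seq I) (F : I -> B) :
  (forall i, P (F i)) -> P (\sum_(i <- r) F i).
Proof. by move=> PF; elim/big_ind: _. Qed.

Lemma cone_prod (I : Type) (r : seq I) (F : I -> B) :
  (forall i, P (F i)) -> P (\prod_(i <- r) F i).
Proof. by move=> PF; elim/big_ind: _. Qed.

Lemma coneX x n : P x -> P (x ^+ n).
Proof. by move=> Px; elim: n => [|n IH]; rewrite ?expr0// exprS; apply: PM. Qed.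

Lemma cone_leX x y n : P x -> P y -> P (y - x) -> P (y ^+ n - x ^+ n).
Proof.
move=> Px Py Pxy; rewrite subrXX; apply: PM => //.
by apply: cone_sum => i; apply: PM; apply: coneX.
Qed.

Lemma cone_le_prod (I : Type) (r : seq I) (F G : I -> B) :
  (forall i, P (F i)) -> (forall i, P (G i)) -> (forall i, P (G i - F i)) ->
  P (\prod_(i <- r) G i - \prod_(i <- r) F i).
Proof.
move=> PF PG PFG; elim: r => [|i r IH]; first by rewrite !big_nil subrr.
rewrite !big_cons.
have -> : G i * \prod_(j <- r) G j - F i * \prod_(j <- r) F j =
   (G i - F i) * \prod_(j <- r) G j +
   F i * (\prod_(j <- r) G j - \prod_(j <- r) F j) by ring.
by apply: PD; apply: PM => //; apply: cone_prod.
Qed.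

(* Convexity of [u |-> (1 - g u)^m] on [0, 1]: it lies below its chord. *)
Lemma cone_chord (g u : B) m : P g -> P (1 - g) -> P u -> P (1 - u) ->
  P (1 - (1 - (1 - g) ^+ m) * u - (1 - g * u) ^+ m).
Proof.
move=> Pg Pg' Pu Pu'.
have Pgu : P (1 - g * u).
  have -> : 1 - g * u = (1 - u) + (1 - g) * u by ring.
  by apply: PD => //; apply: PM.
have Pm k : P (1 - (1 - g) ^+ k).
  elim: k => [|k IH]; first by rewrite expr0 subrr.
  have -> : 1 - (1 - g) ^+ k.+1 = (1 - (1 - g) ^+ k) * (1 - g) + g.
    by rewrite exprSr; ring.
  by apply: PD => //; apply: PM.
elim: m => [|m IH]; first by rewrite !expr0 !subrr mul0r subr0 subrr.
have -> : 1 - (1 - (1 - g) ^+ m.+1) * u - (1 - g * u) ^+ m.+1 =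
  (1 - (1 - (1 - g) ^+ m) * u - (1 - g * u) ^+ m) * (1 - g * u) +
  g * (1 - (1 - g) ^+ m) * (u * (1 - u)) by rewrite !exprSr; ring.
by apply: PD; apply: PM => //; apply: PM.
Qed.

(** Weierstrass product inequality. The error made at each factor is [g * u i] times one minus the
    remaining product, so the induction also needs the product to stay below 1. *)
Lemma cone_weierstrass (I : Type) (r : seq I) (g : B) (u : I -> B) :
  P g -> (forall i, P (u i)) -> (forall i, P (1 - g * u i)) ->
  P (\prod_(i <- r) (1 - g * u i) - (1 - g * \sum_(i <- r) u i)).
Proof.
move=> Pg Pu Pgu; elim: r => [|i r IH].
  by rewrite !big_nil mulr0 subr0 subrr.
rewrite !big_cons.
have Q : P (1 - \prod_(j <- r) (1 - g * u j)).
  have := @cone_le_prod _ r (fun j => 1 - g * u j) (fun=> 1) Pgu (fun=> P1).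
  rewrite big1_eq; apply => j.
  by rewrite opprB addrCA subrr addr0; apply: PM.
set p := \prod_(j <- r) _ in IH Q *; set s := \sum_(j <- r) _ in IH *.
have -> : (1 - g * u i) * p - (1 - g * (u i + s)) =
  (p - (1 - g * s)) + g * u i * (1 - p) by ring.
by apply: PD => //; apply: PM => //; apply: PM.
Qed.

End Cone.

(** * Laplacians of generators, random coins and the Dirichlet form *)

Section SpectralGap.
Variables (R : realType) (X : finZmodType).
Local Notation A := (group_algebra R X).
Implicit Types (f g x y : A) (s : X).

Definition psd x := forall f, 0 <= dot (x * f) f.

(* The psd elements form a cone closed under products; this strengthening makes
   that closure immediate and still contains all the squares [g * star g]. *)
Definition pos x := forall y, psd y -> psd (x * y).

Lemma psd1 : psd 1. Proof. by move=> f; rewrite mul1r dot_ge0. Qed.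

Lemma pos_psd x : pos x -> psd x.
Proof. by move=> px; rewrite -[x]mulr1; apply: px; apply: psd1. Qed.

Lemma pos1 : pos 1. Proof. by move=> y; rewrite mul1r. Qed.

Lemma posM x y : pos x -> pos y -> pos (x * y).
Proof. by move=> px py z pz; rewrite -mulrA; apply/px/py. Qed.

Lemma posD x y : pos x -> pos y -> pos (x + y).
Proof.
move=> px py z pz f; rewrite !mulrDl dotDl.
by rewrite addr_ge0// ?(px z pz) ?(py z pz).
Qed.

Lemma posZ (a : R) x : 0 <= a -> pos x -> pos (a *: x).
Proof.
by move=> a0 px z pz f; rewrite -!scalerAl dotZl mulr_ge0// (px z pz).
Qed.

Lemma pos0 : pos 0.
Proof. by rewrite -(scale0r 1); apply: posZ => //; apply: pos1. Qed.

Lemma pos_square g : pos (g * star g).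
Proof.
move=> y py f; rewrite -2!mulrA dotM (mulrCA (star g)); exact: py.
Qed.

(** The factor 1/4 places this element between 0 and 1 in the order given by [pos]. *)
Definition lapl s : A := 4^-1 *: ((1 - dirac_alg R s) * star (1 - dirac_alg R s)).

Lemma dirac_star s : dirac_alg R s * star (dirac_alg R s) = 1.
Proof. by rewrite star_dirac -dirac_algD subrr dirac_alg0. Qed.

Lemma laplE s : lapl s = 4^-1 *: (2 - dirac_alg R s - star (dirac_alg R s)).
Proof.
congr (_ *: _); rewrite starB star1.
have := dirac_star s; set d := dirac_alg R s; set e := star d => de.
have -> : (1 - d) * (1 - e) = 1 - d - e + d * e by ring.
by rewrite de; ring.
Qed.

Lemma scale4V (x : A) : 4^-1 *: (4 * x) = x.
Proof. by rewrite mulr_natl -(@scaler_nat R A) scalerA mulVf ?scale1r// pnatr_eq0. Qed.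

Lemma pos_lapl s : pos (lapl s).
Proof. by apply: posZ; [rewrite invr_ge0|apply: pos_square]. Qed.

Lemma pos_1lapl s : pos (1 - lapl s).
Proof.
suff -> : 1 - lapl s = 4^-1 *: ((1 + dirac_alg R s) * star (1 + dirac_alg R s)).
  by apply: posZ; [rewrite invr_ge0|apply: pos_square].
rewrite laplE starD star1 -{1}(scale4V 1) -scalerBr; congr (_ *: _).
have := dirac_star s; set d := dirac_alg R s; set e := star d => de.
have -> : (1 + d) * (1 + e) = 1 + d + e + d * e by ring.
by rewrite de; ring.
Qed.

Lemma dot_lapl s f :
  dot (lapl s * f) f = 2^-1 * (dot f f - dot (dirac_alg R s * f) f).
Proof.
rewrite laplE -scalerAl dotZl !mulrBl !dotBl mulr_natl -(@scaler_nat R A) dotZl.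
rewrite [dot (star _ * _) _]dotM starK [dot f (_ * _)]dotC; by field.
Qed.

Definition coin (p : R) s : A := (1 - p) *: 1 + p *: dirac_alg R s.

Lemma coin_star p s : coin p s * star (coin p s) = 1 - (4 * p * (1 - p)) *: lapl s.
Proof.
rewrite laplE scalerA /coin starD !starZ star1.
have -> : 4 * p * (1 - p) / 4 = p * (1 - p) by field.
have := dirac_star s; set d := dirac_alg R s; set e := star d => de.
rewrite !cstE cstM cstB cst1 mulr1; set c := cst _ p.
have -> : (1 - c + c * d) * (1 - c + c * e) =
  (1 - c) * (1 - c) + c * (1 - c) * (d + e) + c * c * (d * e) by ring.
by rewrite de; ring.
Qed.

Lemma mass_coin (p : R) s : mass (coin p s) = 1.
Proof.
rewrite /coin massD !massZ mass1 mulr1.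
have -> : mass (dirac_alg R s) = 1.
  rewrite /mass (bigD1 s)//= ffunE eqxx big1 ?addr0// => y /negPf xy.
  by rewrite ffunE xy.
by rewrite mulr1 subrK.
Qed.

Lemma mass_prod_coin (d : nat) (p : R) (z : 'I_d -> X) :
  mass (\prod_i coin p (z i) : A) = 1.
Proof. by elim/big_rec: _ => [|i x _ Hx]; rewrite ?mass1// massM mass_coin mul1r. Qed.

(* Subtracting the constant [N^-1] from the kernel does not change its action on
   mean-zero functions; then Cauchy-Schwarz row by row. *)
Lemma contraction_mass1 (b : A) f : mass b = 1 -> mass f = 0 ->
  dot (b * f) (b * f) <= (#|X|%:R * dot b b - 1) * dot f f.
Proof.
move=> b1 f0; set N : R := #|X|%:R.
have N0 : N != 0 by rewrite pnatr_eq0 -lt0n; apply/card_gt0P; exists 0.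
pose e : A := [ffun=> N^-1].
have bf : b * f = (b - e) * f.
  suff -> : (b - e) * f = b * f - e * f.
    suff -> : e * f = 0 by rewrite subr0.
    apply/ffunP => x; rewrite convE algE; under eq_bigr do rewrite ffunE.
    rewrite -mulr_sumr (reindex_inj (inj_comp (addrI x) (@oppr_inj X))) /=.
    under eq_bigr do rewrite opprB addrCA subrr addr0.
    by rewrite -/(mass f) f0 mulr0.
  by rewrite mulrBl.
have ebe : dot (b - e) (b - e) = dot b b - N^-1.
  have be : dot b e = N^-1.
    rewrite dotE; under eq_bigr do rewrite [e _]ffunE.
    by rewrite -mulr_suml -/(mass b) b1 mul1r.
  have ee : dot e e = N^-1.
    rewrite dotE; under eq_bigr do rewrite !ffunE.
    by rewrite sumr_const -[_ *+ _]mulr_natl mulrA divff ?mul1r.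
  by rewrite dotBl ![dot _ (b - e)]dotC !dotBl ee (dotC e b) be; ring.
rewrite bf {1}dotE.
have -> : (N * dot b b - 1) * dot f f = \sum_(x : X) (dot (b - e) (b - e) * dot f f).
  by rewrite sumr_const -[_ *+ _]mulr_natl ebe mulrA mulrBr divff.
apply: ler_sum => x _; rewrite -expr2.
have -> : ((b - e) * f) x = dot (b - e) (dirac_alg R x * star f).
  by rewrite dotE convE; apply: eq_bigr => y _; rewrite dirac_algM starE opprB.
apply: le_trans (dot_CS _ _) _; rewrite le_eqVlt; apply/orP; left; apply/eqP.
congr (_ * _); rewrite dotM mulrA [star _ * _]mulrC dirac_star mul1r.
by rewrite /dot starK mulrC.
Qed.

(** Iterated Cauchy-Schwarz, in place of Jensen's inequality for a spectral measure. Each round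
    squares the operator, which is why the exponents below are powers of two. *)
Lemma dot_pow2 (x f : A) k : psd x -> star x = x ->
  dot (x * f) f ^+ (2 ^ k) <= dot (x ^+ (2 ^ k) * f) f * dot f f ^+ (2 ^ k).-1.
Proof.
move=> px sx; elim: k => [|k IH]; first by rewrite expn0 !expr1 expr0 mulr1.
rewrite expnSr exprM.
apply: (@le_trans _ _ ((dot (x ^+ (2 ^ k) * f) f * dot f f ^+ (2 ^ k).-1) ^+ 2)).
  have b0 : 0 <= dot (x * f) f ^+ (2 ^ k) by rewrite exprn_ge0// px.
  by rewrite lerXn2r// nnegrE// (le_trans b0).
rewrite exprMn.
apply: (@le_trans _ _ ((dot (x ^+ (2 ^ k) * f) (x ^+ (2 ^ k) * f) * dot f f) *
   (dot f f ^+ (2 ^ k).-1) ^+ 2)).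
  by rewrite ler_wpM2r ?exprn_ge0 ?dot_ge0// dot_CS.
rewrite dotC dotM starX sx mulrA -exprD addnn -muln2 dotC -mulrA -exprM -exprS.
by rewrite le_eqVlt; apply/orP; left; apply/eqP; congr (_ * _ ^+ _); have := expn_gt0 2 k; case: (2 ^ k)%N => // m _; rewrite !mulnS /= muln2 -muln2 mulnC.
Qed.

Lemma star_lapl s : star (lapl s) = lapl s.
Proof. by rewrite /lapl starZ starM starK mulrC. Qed.

(** With q = 2^-l and m = 2^(l+j), the product of the squared coins dominates G^m, where G is 1
    minus q times the sum of the Laplacians. Smallness of the product on mean-zero functions thus
    bounds the quadratic form of G^m, [dot_pow2] takes the m-th root, and G <= rho is the required
    lower bound, since 1 / q >= d. *)
Lemma gap_of_coins (d : nat) (z : 'I_d -> X) (p del rho : R) (l j : nat) (f : A) :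
  0 <= p <= 1 -> (d <= 2 ^ l)%N -> 0 <= rho -> mass f = 0 ->
  (1 - (2 ^ l)%:R^-1) ^+ (2 ^ (l + j)) <= 1 - 4 * p * (1 - p) ->
  #|X|%:R * dot (\prod_i coin p (z i)) (\prod_i coin p (z i)) - 1 <= del ->
  del <= rho ^+ (2 ^ (l + j)) ->
  d%:R * (1 - rho) * dot f f <= \sum_i dot (lapl (z i) * f) f.
Proof.
move=> /andP[p0 p1] dl rho0 f0 hpow hdel hrho.
set q := (2 ^ l)%:R^-1 : R; set m := (2 ^ (l + j))%N.
have l0 : 0 < (2 ^ l)%:R :> R by rewrite ltr0n expn_gt0.
have q0 : 0 <= q by rewrite invr_ge0 ltW.
have q1 : q <= 1 by rewrite invf_le1// ler1n expn_gt0.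
have [c0 c1 cD cM] := And4 pos0 pos1 posD posM.
have pq : pos (cst X q) by apply: posZ => //; apply: pos1.
have pq' : pos (1 - (cst X q)).
  by rewrite -(cst1 R X) -cstB; apply: posZ; [rewrite subr_ge0|apply: pos1].
set al := 4 * p * (1 - p).
set G : A := 1 - (cst X q) * \sum_i lapl (z i).
pose C i := coin p (z i) * star (coin p (z i)).
have p1q i : pos (1 - (cst X q) * lapl (z i)).
  have -> : 1 - (cst X q) * lapl (z i) = (1 - lapl (z i)) + (1 - (cst X q)) * lapl (z i) by ring.
  by apply: posD; [exact: pos_1lapl|apply: posM => //; exact: pos_lapl].
have pCk i : pos ((1 - (cst X q) * lapl (z i)) ^+ m) by exact: (coneX c1 cM).
(* The squared coin is affine in the Laplacian and the power lies below its chord, so only the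
   endpoints 0 and 1 matter; at 1 the comparison is [hpow]. *)
have pC i : pos (C i - (1 - (cst X q) * lapl (z i)) ^+ m).
  have -> : C i - (1 - (cst X q) * lapl (z i)) ^+ m =
    (1 - (1 - (1 - (cst X q)) ^+ m) * lapl (z i) - (1 - (cst X q) * lapl (z i)) ^+ m)
    + (1 - al - (1 - q) ^+ m) *: lapl (z i).
    rewrite /C coin_star -/al !cstE !cstB cstX !cst1 cstB cst1; ring.
  apply: posD; last by apply: posZ; [rewrite subr_ge0|exact: pos_lapl].
  apply: (cone_chord c0 cD cM _ pq pq'); [exact: pos_lapl|exact: pos_1lapl].
(* Positivity of G comes from d <= 2^l: it is a combination of 1 and the [1 - lapl (z i)] with
   nonnegative coefficients. *)
have pG : pos G.
  have -> : G = (1 - q * d%:R) *: 1 + q *: \sum_i (1 - lapl (z i)).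
    rewrite /G sumrB sumr_const card_ord !cstE mulr1.
    by rewrite cstB cstM cst1 cst_nat; ring.
  apply: posD; apply: posZ => //.
  - by rewrite subr_ge0 mulrC ler_pdivrMr// mul1r ler_nat.
  - by apply: (cone_sum c0 cD) => i; exact: pos_1lapl.
have pprod : pos (\prod_i C i - G ^+ m).
  have -> : \prod_i C i - G ^+ m =
     (\prod_i C i - \prod_i (1 - (cst X q) * lapl (z i)) ^+ m) +
     ((\prod_i (1 - (cst X q) * lapl (z i))) ^+ m - G ^+ m).
    by rewrite prodrXl; ring.
  apply: posD.
  - apply: (cone_le_prod c0 c1 cD cM) => // i; exact: pos_square.
  - apply: (cone_leX c0 c1 cD cM) => //; first exact: (cone_prod c1 cM).
    by apply: (cone_weierstrass c0 c1 cD cM) => // i; exact: pos_lapl.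
have sG : star G = G.
  rewrite /G starB star1 -cstE starZ; congr (_ - _ *: _).
  by elim/big_rec: _ => [|i x _ Hx]; [apply/ffunP => x; rewrite starE !algE|rewrite starD star_lapl Hx].
have hGm : dot (G ^+ m * f) f <= del * dot f f.
  apply: (@le_trans _ _ (dot ((\prod_i C i) * f) f)).
    rewrite -subr_ge0 -dotBl -mulrBl.
    by apply: (pos_psd pprod).
  apply: (@le_trans _ _ ((#|X|%:R * dot (\prod_i coin p (z i)) (\prod_i coin p (z i)) - 1) * dot f f)).
    rewrite /C big_split -star_prod.
    rewrite /= -[in leLHS]mulrA [in leLHS]mulrCA dotM starK dotC.
    rewrite -[X in dot X _]/(_ * f); apply: contraction_mass1 => //.
    exact: mass_prod_coin.
  by rewrite ler_wpM2r// dot_ge0.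
have hG : dot (G * f) f <= rho * dot f f.
  have := dot_pow2 f (l + j) (pos_psd pG) sG; rewrite -/m => h.
  have m0 : (0 < m)%N by rewrite expn_gt0.
  rewrite -(ler_pXn2r m0) ?nnegrE ?mulr_ge0 ?dot_ge0//; last exact: (pos_psd pG).
  apply: (le_trans h); rewrite exprMn -[in leRHS](prednK m0) [dot f f ^+ m.-1.+1]exprS mulrA.
  rewrite ler_wpM2r ?exprn_ge0 ?dot_ge0//.
  by apply: (le_trans hGm); rewrite (prednK m0) ler_wpM2r ?dot_ge0.
have hs : dot (G * f) f = dot f f - q * \sum_i dot (lapl (z i) * f) f.
  rewrite /G mulrBl mul1r dotBl -cstE -scalerAl dotZl; congr (_ - _ * _).
  rewrite mulr_suml; elim/big_rec2: _ => [|i x y _ <-]; last by rewrite dotDl.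
  by rewrite dotE big1// => x _; rewrite algE mul0r.
set Sg := \sum_i dot _ f in hs *.
have h2 : (1 - rho) * dot f f <= q * Sg by lra.
have Sg0 : 0 <= Sg by rewrite sumr_ge0// => i _; exact: (pos_psd (@pos_lapl (z i))).
apply: (@le_trans _ _ (d%:R * (q * Sg))).
  by rewrite -mulrA ler_wpM2l.
rewrite mulrA -[leRHS]mul1r ler_wpM2r//.
by rewrite ler_pdivrMr// mul1r ler_nat.
Qed.

End SpectralGap.

(** * Heat kernel and Euler approximation *)

Lemma cvg_sum_fin (R : realType) (I : Type) (r : seq I) (u : I -> nat -> R)
  (l : I -> R) : (forall i, u i n @[n --> \oo] --> l i) ->
  \sum_(i <- r) u i n @[n --> \oo] --> \sum_(i <- r) l i.
Proof.
move=> h; elim: r => [|i r IH].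
  by rewrite big_nil; under eq_fun do rewrite big_nil; exact: cvg_cst.
rewrite big_cons; under eq_fun do rewrite big_cons.
by apply: cvgD => //; exact: h.
Qed.

Lemma cvg_divn (R : realType) (a : R) : a / n%:R @[n --> \oo] --> (0 : R).
Proof.
rewrite -(mulr0 a) -(cvg_shiftS (fun n => a / n%:R)); apply: cvgMl_tmp.
exact: (@cvg_harmonic R).
Qed.

Lemma ffact_le_expn (n j : nat) : (n ^_ j <= n ^ j)%N.
Proof.
elim: j => [|j IH]; first by rewrite ffactn0.
by rewrite ffactnSr expnSr leq_mul// leq_subr.
Qed.

Lemma bernoulli_ineq (R : realType) (x : R) n : 0 <= x <= 1 -> 1 - n%:R * x <= (1 - x) ^+ n.
Proof.
move=> /andP[x0 x1]; elim: n => [|n IH]; first by rewrite mul0r subr0.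
rewrite exprS; apply: (@le_trans _ _ ((1 - x) * (1 - n%:R * x))).
  rewrite -natr1; have : 0 <= n%:R * x * x by rewrite !mulr_ge0.
  by move=> h; lra.
by rewrite ler_wpM2l// subr_ge0.
Qed.

Lemma sum_fact_le_expR (R : realType) (t : R) m : 0 <= t ->
  \sum_(j < m) t ^+ j / j`!%:R <= expR t.
Proof.
move=> t0; have := @nondecreasing_cvgn_le R (series (exp_coeff t)).
rewrite -/(expR t) => /(_ _ (@is_cvg_series_exp_coeff _ t) m).
rewrite /series /= big_mkord; apply.
by apply/nondecreasing_seqP => k; rewrite /series /= big_nat_recr//= lerDl exp_coeff_ge0.
Qed.

Lemma euler_upper (R : realType) (t : R) n : 0 <= t -> (0 < n)%N ->
  (1 + t / n%:R) ^+ n <= expR t.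
Proof.
move=> t0 n0; have np : 0 < n%:R :> R by rewrite ltr0n.
have -> : expR t = expR (t / n%:R) ^+ n by rewrite -expRM_natr mulfVK// lt0r_neq0.
by rewrite lerXn2r// ?nnegrE ?expR_ge0 ?addr_ge0 ?divr_ge0 ?expR_ge1Dx// ltW.
Qed.

(** From exp(x)(1 - x) <= 1 one gets 1 + x >= exp(x)(1 - x^2) with x = t / n; Bernoulli's inequality
    handles the n-th power of the last factor. *)
Lemma euler_lower (R : realType) (t : R) n : 0 <= t -> (0 < n)%N -> t <= n%:R ->
  expR t * (1 - t ^+ 2 / n%:R) <= (1 + t / n%:R) ^+ n.
Proof.
move=> t0 n0 tn; have np : 0 < n%:R :> R by rewrite ltr0n.
set x := t / n%:R; have x0 : 0 <= x by rewrite divr_ge0 // ltW.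
have x1 : x <= 1 by rewrite ler_pdivrMr// mul1r.
have -> : t ^+ 2 / n%:R = n%:R * x ^+ 2.
  by rewrite /x; field; rewrite lt0r_neq0.
have -> : t = x * n%:R by rewrite mulfVK// lt0r_neq0.
rewrite expRM_natr.
apply: (@le_trans _ _ (expR x ^+ n * (1 - x ^+ 2) ^+ n)).
  rewrite ler_wpM2l ?exprn_ge0 ?expR_ge0// bernoulli_ineq//.
  by rewrite exprn_ge0//= expr_le1.
rewrite -exprMn lerXn2r ?nnegrE ?mulr_ge0 ?expR_ge0 ?subr_ge0 ?expr_le1 ?addr_ge0//.
have -> : 1 - x ^+ 2 = (1 - x) * (1 + x) by ring.
rewrite mulrA -[leRHS]mul1r ler_wpM2r ?addr_ge0//.
have := expR_ge1Dx (- x); rewrite expRN => h.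
apply: (@le_trans _ _ (expR x * (expR x)^-1)); first by rewrite ler_wpM2l ?expR_ge0.
by rewrite divff// gt_eqF// expR_gt0.
Qed.

Section HeatKernel.
Variables (R : realType) (X : finZmodType) (S : {set X}).
Local Notation A := (group_algebra R X).
Hypothesis S0 : (0 < #|S|)%N.
Implicit Types (f g : A) (x y s : X) (t : R).

Definition step_law : A := [ffun x => #|S|%:R^-1 * (x \in S)%:R].

Local Notation kap := step_law.

Let cS : 0 < #|S|%:R :> R. Proof. by rewrite ltr0n. Qed.

Lemma step_law_ge0 x : 0 <= kap x.
Proof. by rewrite ffunE mulr_ge0// invr_ge0. Qed.

Lemma mass_step_law : mass kap = 1.
Proof.
rewrite /mass; under eq_bigr do rewrite ffunE.
rewrite -mulr_sumr -natr_sum -big_mkcond /= sum1_card mulVf//.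
exact: lt0r_neq0.
Qed.

Lemma walk_kernelE x y : walk_kernel R S x y = kap (y - x).
Proof.
rewrite /walk_kernel ffunE; congr (_ * _).
have [yS|yS] := boolP (y - x \in S).
  rewrite (bigD1 (y - x)) //= addrCA subrr addr0 eqxx big1 ?addr0// => z /andP[_ /negPf zy].
  by rewrite [x + z]addrC -subr_eq eq_sym zy.
rewrite big1// => z zS; case: eqP => // yE; move: yS.
by rewrite yE addrAC subrr add0r zS.
Qed.

Lemma walk_powerE k x y : walk_power R S k x y = (kap ^+ k) (y - x).
Proof.
elim: k x y => [|k IH] x y.
  rewrite /walk_power !expr0 mxE one_alg_coef subr_eq0 (inj_eq enum_rank_inj).
  by rewrite eq_sym.
rewrite /walk_power exprS mxE.
rewrite (reindex (@enum_rank X)) /=; last exact/onW_bij/enum_rank_bij.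
rewrite exprS convE [RHS](reindex_inj (addIr (- x))) /=.
apply: eq_bigr => z _; rewrite -/(walk_power R S k z y) IH mxE !enum_rankK walk_kernelE.
by rewrite opprB addrA subrK.
Qed.

Definition heat t : A := [ffun x => heat_kernel S t 0 x].

Lemma heat_kernelE t x y : heat_kernel S t x y = heat t (y - x).
Proof.
rewrite ffunE /heat_kernel.
suff -> : (fun k => walk_power R S k x y * t ^+ k / k`!%:R) =
    (fun k => walk_power R S k 0 (y - x) * t ^+ k / k`!%:R) by [].
by apply/funext => k; rewrite !walk_powerE subr0.
Qed.

Lemma step_lawX_ge0 k x : 0 <= (kap ^+ k) x.
Proof. by apply: exp_alg_ge0; exact: step_law_ge0. Qed.

Lemma mass_step_lawX k : mass (kap ^+ k) = 1.
Proof. by rewrite massX mass_step_law expr1n. Qed.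

Lemma step_lawX_le1 k x : (kap ^+ k) x <= 1.
Proof. by rewrite -(mass_step_lawX k) coef_le_mass// => z; exact: step_lawX_ge0. Qed.

Definition heat_partial t m : A := \sum_(0 <= j < m) (t ^+ j / j`!%:R) *: kap ^+ j.

Lemma heat_partialE t m x :
  heat_partial t m x = \sum_(0 <= j < m) (t ^+ j / j`!%:R) * (kap ^+ j) x.
Proof. by rewrite /heat_partial algE; apply: eq_bigr => j _; rewrite algE. Qed.

Lemma heat_partial_cvg t x : 0 <= t ->
  expR (- t) * heat_partial t m x @[m --> \oo] --> heat t x.
Proof.
move=> t0; rewrite ffunE /heat_kernel; apply: cvgMl_tmp.
under eq_fun do rewrite heat_partialE.
have -> : (fun k => walk_power R S k 0 x * t ^+ k / k`!%:R) =
    (fun k => (t ^+ k / k`!%:R) * (kap ^+ k) x).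
  by apply/funext => k; rewrite walk_powerE subr0 -mulrA mulrC.
apply: (@series_le_cvg _ _ (exp_coeff t)) => [k|k|k|].
- by rewrite mulr_ge0 ?step_lawX_ge0// divr_ge0// exprn_ge0.
- exact: exp_coeff_ge0.
- by rewrite -[leRHS]mulr1 ler_wpM2l ?step_lawX_le1// divr_ge0// exprn_ge0.
- exact: is_cvg_series_exp_coeff.
Qed.

(** A power of one element, so that estimates for a single short step can be iterated before letting
    n grow. *)
Definition euler_heat t n : A := expR (- t) *: (1 + (t / n%:R) *: kap) ^+ n.

(** The binomial weights are at most the Poisson ones term by term, so the difference is nonnegative
    and at most the total missing weight, which [euler_lower] bounds. *)
Lemma euler_heat_close t n x : 0 <= t -> (0 < n)%N -> t <= n%:R ->
  0 <= heat t x - euler_heat t n x <= t ^+ 2 / n%:R.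
Proof.
move=> t0 n0 tn; have np : 0 < n%:R :> R by rewrite ltr0n.
pose c j : R := t ^+ j / j`!%:R.
pose w j : R := 'C(n, j)%:R * (t / n%:R) ^+ j.
have c0 j : 0 <= c j by rewrite divr_ge0// exprn_ge0.
have wc j : w j <= c j.
  rewrite /w /c expr_div_n mulrCA ler_wpM2l ?exprn_ge0//.
  rewrite ler_pdivrMr ?exprn_gt0//.
  rewrite ler_pdivlMl ?ltr0n ?fact_gt0// -natrX -natrM ler_nat mulnC.
  by rewrite bin_ffact ffact_le_expn.
have WE : ((1 + (t / n%:R) *: kap) ^+ n) x = \sum_(0 <= j < n.+1) w j * (kap ^+ j) x.
  rewrite exprDn algE big_mkord; apply: eq_bigr => j _.
  by rewrite expr1n mul1r exprZn -(@scaler_nat R A) !algE /w mulrA.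
have W1 : (1 + t / n%:R) ^+ n = \sum_(0 <= j < n.+1) w j.
  rewrite exprDn big_mkord; apply: eq_bigr => j _.
  by rewrite expr1n mul1r -mulr_natl.
have key m : (n.+1 <= m)%N ->
    0 <= heat_partial t m x - ((1 + (t / n%:R) *: kap) ^+ n) x <= expR t * (t ^+ 2 / n%:R).
  move=> nm.
  have -> : heat_partial t m x - ((1 + (t / n%:R) *: kap) ^+ n) x =
      \sum_(0 <= j < n.+1) (c j - w j) * (kap ^+ j) x +
      \sum_(n.+1 <= j < m) c j * (kap ^+ j) x.
    rewrite heat_partialE WE (@big_cat_nat _ _ _ n.+1)//= addrAC -sumrB.
    by congr (_ + _); apply: eq_bigr => j _; rewrite mulrBl.
  have k0 := step_lawX_ge0 ^~ x; have k1 := step_lawX_le1 ^~ x.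
  apply/andP; split.
    by rewrite addr_ge0// sumr_ge0// => j _; rewrite mulr_ge0// subr_ge0.
  apply: (@le_trans _ _ (\sum_(0 <= j < n.+1) (c j - w j) + \sum_(n.+1 <= j < m) c j)).
    apply: lerD; apply: ler_sum => j _; rewrite -[leRHS]mulr1 ler_wpM2l//.
    by rewrite subr_ge0.
  rewrite sumrB addrAC -(@big_cat_nat _ _ _ n.+1)//= -W1.
  have := euler_lower t0 n0 tn; have := sum_fact_le_expR m t0.
  by rewrite big_mkord /c; lra.
have e0 : 0 < expR (- t) := expR_gt0 _.
have ee : expR (- t) * expR t = 1 by rewrite mulrC expRxMexpNx_1.
have hc : expR (- t) * heat_partial t m x - euler_heat t n x @[m --> \oo] -->
    heat t x - euler_heat t n x.
  by apply: cvgB; [exact: heat_partial_cvg|exact: cvg_cst].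
apply/andP; split; [apply: (cvgr_to_ge hc)|apply: (cvgr_to_le hc)]; near=> m.
- rewrite /euler_heat scale_alg_coef -mulrBr mulr_ge0 ?(ltW e0)//.
  have nm : (n.+1 <= m)%N by near: m; exact: nbhs_infty_ge.
  by have /andP[] := key m nm.
- rewrite /euler_heat scale_alg_coef -mulrBr.
  have -> : t ^+ 2 / n%:R = expR (- t) * (expR t * (t ^+ 2 / n%:R)) by rewrite mulrA ee mul1r.
  rewrite ler_wpM2l ?(ltW e0)//.
  have nm : (n.+1 <= m)%N by near: m; exact: nbhs_infty_ge.
  by have /andP[] := key m nm.
Unshelve. all: by end_near. Qed.

Lemma euler_heat_cvg t x : 0 <= t -> euler_heat t n x @[n --> \oo] --> heat t x.
Proof.
move=> t0; have h : heat t x - t ^+ 2 / n%:R @[n --> \oo] --> heat t x.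
  by rewrite -[X in _ --> X]subr0; apply: cvgB; [exact: cvg_cst|exact: cvg_divn].
apply: (squeeze_cvgr _ h (cvg_cst _)); near=> n.
have n0 : (0 < n)%N by near: n; exact: nbhs_infty_gt.
have tn : t <= n%:R by near: n; exact: nbhs_infty_ger.
by have := euler_heat_close x t0 n0 tn; lra.
Unshelve. all: by end_near. Qed.

End HeatKernel.

(** * The l1 norm and limits of convolutions *)

Section Norm1.
Variables (R : realType) (X : finZmodType).
Local Notation A := (group_algebra R X).
Implicit Types (f g h : A) (x y s : X).

Definition norm1 f : R := \sum_x `|f x|.

Lemma norm1M f g : norm1 (f * g) <= norm1 f * norm1 g.
Proof.
pose a (f : A) : A := [ffun x => `|f x|].
have aE h : norm1 h = mass (a h) by apply: eq_bigr => x _; rewrite ffunE.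
rewrite !aE -massM; apply: ler_sum => x _; rewrite ffunE !convE.
apply: le_trans (ler_norm_sum _ _ _) _; apply: ler_sum => y _.
by rewrite normrM !ffunE.
Qed.

Lemma norm1_ge0 f : 0 <= norm1 f. Proof. exact: sumr_ge0. Qed.

Lemma norm1D f g : norm1 (f + g) <= norm1 f + norm1 g.
Proof. by rewrite /norm1 -big_split; apply: ler_sum => x _; rewrite algE ler_normD. Qed.

Lemma norm1_mass f : (forall x, 0 <= f x) -> norm1 f = mass f.
Proof. by move=> f0; apply: eq_bigr => x _; rewrite ger0_norm. Qed.

Lemma coef_le_norm1 f x : `|f x| <= norm1 f.
Proof. by rewrite /norm1 (bigD1 x)//= lerDl sumr_ge0. Qed.

Lemma norm1X f n : norm1 f <= 1 -> norm1 (f ^+ n) <= 1.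
Proof.
move=> f1; elim: n => [|n IH].
  by rewrite expr0 norm1_mass ?mass1// => x; rewrite one_alg_coef.
by rewrite exprS (le_trans (norm1M _ _))// mulr_ile1// norm1_ge0.
Qed.

Lemma norm1_subX f g n : norm1 f <= 1 -> norm1 g <= 1 ->
  norm1 (f ^+ n - g ^+ n) <= n%:R * norm1 (f - g).
Proof.
move=> f1 g1; elim: n => [|n IH].
  by rewrite !expr0 subrr mul0r /norm1 big1// => x _; rewrite algE normr0.
have -> : f ^+ n.+1 - g ^+ n.+1 = f * (f ^+ n - g ^+ n) + (f - g) * g ^+ n.
  by rewrite !exprS; ring.
apply: le_trans (norm1D _ _) _; rewrite -natr1 [leRHS]mulrDl mul1r; apply: lerD.
  apply: le_trans (norm1M _ _) _; rewrite -[leRHS]mul1r.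
  by apply: ler_pM => //; exact: norm1_ge0.
apply: le_trans (norm1M _ _) _; rewrite -[leRHS]mulr1 ler_wpM2l ?norm1_ge0//.
exact: norm1X.
Qed.

Lemma cvg_conv (u v : nat -> A) f g x :
  (forall y, u n y @[n --> \oo] --> f y) -> (forall y, v n y @[n --> \oo] --> g y) ->
  (u n * v n) x @[n --> \oo] --> (f * g) x.
Proof.
move=> hu hv; rewrite convE; under eq_fun do rewrite convE.
by apply: cvg_sum_fin => y; apply: cvgM.
Qed.

Lemma cvg_dot (u v : nat -> A) f g :
  (forall y, u n y @[n --> \oo] --> f y) -> (forall y, v n y @[n --> \oo] --> g y) ->
  dot (u n) (v n) @[n --> \oo] --> dot f g.
Proof.
move=> hu hv; rewrite dotE; under eq_fun do rewrite dotE.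
by apply: cvg_sum_fin => y; apply: cvgM.
Qed.

Lemma conv_le f g h x : (forall y, 0 <= h y) -> (forall y, f y <= g y) ->
  (h * f) x <= (h * g) x.
Proof. by move=> h0 fg; rewrite !convE; apply: ler_sum => y _; rewrite ler_wpM2l. Qed.

End Norm1.

(** * Variance and Jensen's inequality under a probability law *)

Section ProbabilityLaw.
Variables (R : realType) (X : finZmodType) (q : group_algebra R X).
Hypotheses (q0 : forall x, 0 <= q x) (q1 : mass q = 1).

Lemma second_momentE (h : X -> R) (c : R) :
  \sum_y q y * (h y - c) ^+ 2 =
  \sum_y q y * h y ^+ 2 - 2 * c * \sum_y q y * h y + c ^+ 2.
Proof.
have -> : c ^+ 2 = \sum_y c ^+ 2 * q y by rewrite -mulr_sumr -/(mass q) q1 mulr1.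
rewrite mulr_sumr -sumrB -big_split.
by apply: eq_bigr => y _ /=; ring.
Qed.

Lemma second_moment_center (h : X -> R) (c : R) :
  \sum_y q y * h y ^+ 2 - (\sum_y q y * h y) ^+ 2 <= \sum_y q y * (h y - c) ^+ 2.
Proof.
rewrite second_momentE; set m := \sum_y q y * h y.
by have := sqr_ge0 (m - c); rewrite sqrrB; lra.
Qed.

Lemma jensen_sqr (h : X -> R) :
  (\sum_y q y * h y) ^+ 2 <= \sum_y q y * h y ^+ 2.
Proof.
set m := \sum_y q y * h y.
have : 0 <= \sum_y q y * (h y - m) ^+ 2.
  by rewrite sumr_ge0// => y _; rewrite mulr_ge0// sqr_ge0.
by rewrite second_momentE -/m; lra.
Qed.

Lemma conv_contraction (f : group_algebra R X) : dot (q * f) (q * f) <= dot f f.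
Proof.
rewrite dotE; apply: (@le_trans _ _ (\sum_x \sum_y q y * (f (x - y)) ^+ 2)).
  by apply: ler_sum => x _; rewrite -expr2 convE; exact: jensen_sqr.
rewrite exchange_big /=; have -> : dot f f = \sum_y q y * dot f f.
  by rewrite -mulr_suml -/(mass q) q1 mul1r.
apply: ler_sum => y _; rewrite -mulr_sumr ler_wpM2l// dotE.
by rewrite (reindex_inj (addIr y)) /=; apply: ler_sum => x _; rewrite addrK expr2.
Qed.

End ProbabilityLaw.

(** * Semigroup law, L2 decay and local Poincare inequality *)

Section HeatSemigroup.
Variables (R : realType) (X : finZmodType) (S : {set X}).
Local Notation A := (group_algebra R X).
Hypothesis S0 : (0 < #|S|)%N.
Implicit Types (f g h : A) (x y s : X) (t : R).
Local Notation kap := (step_law R S).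
Local Notation heat := (@heat R X S).
Local Notation euler := (@euler_heat R X S).

Let kap0 : forall x, 0 <= kap x. Proof. exact: step_law_ge0. Qed.
Let kap1 : mass kap = 1. Proof. exact: mass_step_law. Qed.

Definition euler_step (a : R) : A := expR (- a) *: (1 + a *: kap).

Lemma euler_heatE t n : (0 < n)%N -> euler t n = euler_step (t / n%:R) ^+ n.
Proof.
move=> n0; rewrite /euler_heat /euler_step exprZn; congr (_ *: _).
by rewrite -expRM_natr mulNr mulfVK// pnatr_eq0 -lt0n.
Qed.

Lemma euler_step_ge0 a x : 0 <= a -> 0 <= euler_step a x.
Proof.
by move=> a0; rewrite /euler_step !algE mulr_ge0 ?expR_ge0// addr_ge0// mulr_ge0.
Qed.

Lemma mass_euler_step a : mass (euler_step a) = expR (- a) * (1 + a).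
Proof. by rewrite /euler_step massZ massD massZ mass1 kap1 mulr1. Qed.

Lemma norm1_euler_step a : 0 <= a -> norm1 (euler_step a) <= 1.
Proof.
move=> a0; rewrite norm1_mass; last by move=> x; exact: euler_step_ge0.
rewrite mass_euler_step expRN mulrC ler_pdivrMr ?expR_gt0// mul1r.
exact: expR_ge1Dx.
Qed.

Lemma euler_stepM a b : euler_step a * euler_step b - euler_step (a + b) =
  (expR (- (a + b)) * (a * b)) *: kap ^+ 2.
Proof.
rewrite /euler_step opprD expRD !cstE !cstM; set ka := kap.
rewrite (_ : cst X (a + b) = cst X a + cst X b); last exact: scalerDl.
ring.
Qed.

Lemma heat_ge0 t x : 0 <= t -> 0 <= heat t x.
Proof.
move=> t0; have h := @euler_heat_cvg R X S S0 t x t0; apply: (cvgr_to_ge h); near=> n.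
rewrite euler_heatE; last by near: n; exact: nbhs_infty_gt.
by apply: exp_alg_ge0 => y; apply: euler_step_ge0; rewrite divr_ge0.
Unshelve. all: by end_near. Qed.

Lemma mass_euler_cvg t : 0 <= t -> expR (- t) * (1 + t / n%:R) ^+ n @[n --> \oo] --> (1 : R).
Proof.
move=> t0; have h : 1 - t ^+ 2 / n%:R @[n --> \oo] --> (1 : R).
  by rewrite -[X in _ --> X]subr0; apply: cvgB; [exact: cvg_cst|exact: cvg_divn].
apply: (squeeze_cvgr _ h (cvg_cst _)); near=> n.
have n0 : (0 < n)%N by near: n; exact: nbhs_infty_gt.
have tn : t <= n%:R by near: n; exact: nbhs_infty_ger.
rewrite expRN; apply/andP; split.
  by rewrite ler_pdivlMl ?expR_gt0// euler_lower.
by rewrite ler_pdivrMl ?expR_gt0// mulr1 euler_upper.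
Unshelve. all: by end_near. Qed.

Lemma mass_heat t : 0 <= t -> mass (heat t) = 1.
Proof.
move=> t0; apply: (@cvg_unique _ (@Rhausdorff R) (mass (euler t n) @[n --> \oo])).
  by apply: cvg_sum_fin => x; exact: euler_heat_cvg.
suff -> : (fun n => mass (euler t n)) = (fun n => expR (- t) * (1 + t / n%:R) ^+ n).
  exact: mass_euler_cvg.
by apply/funext => n; rewrite massZ massX massD massZ mass1 kap1 mulr1.
Qed.

(** Merging two short steps of lengths t / n and u / n costs at most t u / n^2 in l1 norm. The steps
    have norm at most 1, so n such errors add up to t u / n, which vanishes. *)
Lemma heatD t u : 0 <= t -> 0 <= u -> heat (t + u) = heat t * heat u.
Proof.
move=> t0 u0; apply/ffunP => x.
apply: (@cvg_unique _ (@Rhausdorff R) (euler (t + u) n x @[n --> \oo])).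
  by apply: euler_heat_cvg => //; rewrite addr_ge0.
have h : (euler t n * euler u n) x @[n --> \oo] --> (heat t * heat u) x.
  by apply: cvg_conv => y; apply: euler_heat_cvg.
have hd : (t * u) / n%:R @[n --> \oo] --> (0 : R) by exact: cvg_divn.
have hl : (euler t n * euler u n) x - (t * u) / n%:R @[n --> \oo] --> (heat t * heat u) x.
  by rewrite -[X in _ --> X]subr0; apply: cvgB.
have hr : (euler t n * euler u n) x + (t * u) / n%:R @[n --> \oo] --> (heat t * heat u) x.
  by rewrite -[X in _ --> X]addr0; apply: cvgD.
apply: (squeeze_cvgr _ hl hr); near=> n.
have n0 : (0 < n)%N by near: n; exact: nbhs_infty_gt.
have np : 0 < n%:R :> R by rewrite ltr0n.
rewrite -ler_distlC /= -sub_alg_coef; apply: le_trans (coef_le_norm1 _ _) _.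
rewrite !euler_heatE// -exprMn.
set a := t / n%:R; set b := u / n%:R.
have a0 : 0 <= a by rewrite divr_ge0.
have b0 : 0 <= b by rewrite divr_ge0.
have ab0 : 0 <= (t + u) / n%:R by rewrite divr_ge0// addr_ge0.
apply: (@le_trans _ _ (n%:R * (a * b))); last first.
  by rewrite /a /b le_eqVlt; apply/orP; left; apply/eqP; field; rewrite lt0r_neq0.
apply: le_trans (norm1_subX _ _ _) _; rewrite ?norm1_euler_step//.
  by apply: le_trans (norm1M _ _) _; rewrite mulr_ile1 ?norm1_ge0 ?norm1_euler_step.
rewrite ler_wpM2l//.
have -> : euler_step a * euler_step b - euler_step ((t + u) / n%:R) =
    (expR (- (a + b)) * (a * b)) *: kap ^+ 2.
  by rewrite mulrDl euler_stepM.
rewrite norm1_mass => [|y]; last first.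
  by rewrite algE mulr_ge0 ?mulr_ge0 ?expR_ge0 ?step_lawX_ge0.
rewrite massZ massX kap1 expr1n mulr1 -[leRHS]mul1r ler_wpM2r ?mulr_ge0//.
by rewrite expR_le1 oppr_le0 addr_ge0.
Unshelve. all: by end_near. Qed.

Section Decay.
Variable c : R.
Hypothesis gap : forall f, mass f = 0 -> c * dot f f <= dot f f - dot (kap * f) f.

(** The gap controls the term linear in [a]; the quadratic one is only bounded by contraction, but a
    = t / n makes its total t^2 / n. *)
Lemma euler_step_decay a f : 0 <= a -> mass f = 0 ->
  dot (euler_step a * f) (euler_step a * f) <= expR (- (2 * a * c) + a ^+ 2) * dot f f.
Proof.
move=> a0 f0.
have -> : dot (euler_step a * f) (euler_step a * f) =
    expR (- (2 * a)) * (dot f f + 2 * a * dot (kap * f) f + a ^+ 2 * dot (kap * f) (kap * f)).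
  rewrite /euler_step -scalerAl dotZl dotC dotZl mulrA -expRD; congr (expR _ * _); first by ring.
  rewrite mulrDl mul1r -scalerAl dotDl dotZl ![dot _ (f + _)]dotC !dotDl !dotZl.
  by rewrite (dotC f (kap * f)); ring.
have h1 := gap f0; have h2 := conv_contraction kap0 kap1 f.
apply: (@le_trans _ _ (expR (- (2 * a)) * ((1 + 2 * a * (1 - c) + a ^+ 2) * dot f f))).
  rewrite ler_wpM2l ?expR_ge0//.
  have : 2 * a * dot (kap * f) f <= 2 * a * ((1 - c) * dot f f).
    by rewrite ler_wpM2l ?mulr_ge0//; lra.
  have : a ^+ 2 * dot (kap * f) (kap * f) <= a ^+ 2 * dot f f.
    by rewrite ler_wpM2l ?sqr_ge0.
  by lra.
rewrite mulrA ler_wpM2r ?dot_ge0//.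
have -> : - (2 * a * c) + a ^+ 2 = - (2 * a) + (2 * a * (1 - c) + a ^+ 2) by ring.
by rewrite expRD ler_wpM2l ?expR_ge0// -addrA expR_ge1Dx.
Qed.

Lemma heat_decay t f : 0 <= t -> mass f = 0 ->
  dot (heat t * f) (heat t * f) <= expR (- (2 * t * c)) * dot f f.
Proof.
move=> t0 f0.
have hu y : (euler t n * f) y @[n --> \oo] --> (heat t * f) y.
  by apply: cvg_conv => z; [exact: euler_heat_cvg|exact: cvg_cst].
have h := cvg_dot hu hu.
have hr : expR (- (2 * t * c) + t ^+ 2 / n%:R) * dot f f @[n --> \oo] -->
    expR (- (2 * t * c)) * dot f f.
  apply: cvgMr_tmp.
  have he : - (2 * t * c) + t ^+ 2 / n%:R @[n --> \oo] --> - (2 * t * c).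
    by rewrite -[X in _ --> X]addr0; apply: cvgD; [exact: cvg_cst|exact: cvg_divn].
  exact: (continuous_cvg _ (@continuous_expR R _) he).
apply: (ler_cvg_to h hr); near=> n.
have n0 : (0 < n)%N by near: n; exact: nbhs_infty_gt.
have nn : n%:R != 0 :> R by rewrite pnatr_eq0 -lt0n.
rewrite euler_heatE//; set a := t / n%:R.
have -> : - (2 * t * c) + t ^+ 2 / n%:R = (- (2 * a * c) + a ^+ 2) * n%:R.
  by rewrite /a; field.
rewrite expRM_natr.
have a0 : 0 <= a by rewrite divr_ge0.
have E0 := expR_ge0 (- (2 * a * c) + a ^+ 2); have hE := euler_step_decay a0.
move: (expR _) E0 hE => E E0 hE.
elim: (n) => [|k IH]; first by rewrite !expr0 !mul1r.
rewrite [euler_step a ^+ _]exprS -mulrA; apply: le_trans (hE _ _) _.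
  by rewrite massM f0 mulr0.
by rewrite [in leRHS]exprS -mulrA ler_wpM2l ?expR_ge0.
Unshelve. all: by end_near. Qed.

End Decay.

Definition sqf g : A := [ffun x => g x ^+ 2].

(** The carre du champ without its factor 1/2; differences go from x to x - s to match
    convolution. *)
Definition carre g : A := [ffun x => \sum_s kap s * (g (x - s) - g x) ^+ 2].

(** Discrete Bakry-Emery argument: the variance over n + 1 steps splits into that of one step and
    that of n steps applied to [q * g]. Translations commute with the walk, so gradients do not grow
    under averaging. *)
Lemma lazy_local_poincare (a : R) (q : A) n g x : 0 <= a ->
  q = (1 + a)^-1 *: (1 + a *: kap) ->
  (q ^+ n * sqf g) x - (q ^+ n * g) x ^+ 2 <= n%:R * a * (q ^+ n * carre g) x.
Proof.
move=> a0 qdef.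
have a1 : 0 < 1 + a by rewrite ltr_pwDl.
have q0 y : 0 <= q y.
  by rewrite qdef !algE mulr_ge0 ?invr_ge0 ?(ltW a1)// addr_ge0// mulr_ge0.
have q1 : mass q = 1.
  by rewrite qdef massZ massD massZ mass1 kap1 mulr1 mulVf// lt0r_neq0.
have qn0 k y : 0 <= (q ^+ k) y by exact: exp_alg_ge0.
have qE (h : X -> R) : \sum_y q y * h y = (1 + a)^-1 * (h 0 + a * \sum_s kap s * h s).
  rewrite qdef; under eq_bigr do rewrite !algE -mulrA mulrDl -mulrA.
  rewrite -mulr_sumr big_split /= -mulr_sumr; congr (_ * (_ + _)).
  rewrite (bigD1 0)//= eqxx mul1r big1 ?addr0// => y /negPf y0.
  by rewrite y0 mul0r.
(* The second moment is taken about [h y], so only genuine moves contribute; the holding probability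
   of the lazy step, at least 1 / (1 + a), then bounds [carre h y] by (1 + a) times its average. *)
have stepA h y : (q * sqf h) y - (q * h) y ^+ 2 <= a * (q * carre h) y.
  rewrite !convE; under eq_bigr do rewrite ffunE.
  apply: le_trans (second_moment_center q1 (fun z => h (y - z)) (h y)) _.
  rewrite qE subr0 subrr expr0n add0r.
  have -> : \sum_s kap s * (h (y - s) - h y) ^+ 2 = carre h y by rewrite ffunE.
  rewrite (qE (fun z => carre h (y - z))) subr0 mulrCA ler_wpM2l//.
  rewrite ler_wpM2l ?invr_ge0 ?(ltW a1)// lerDl mulr_ge0// sumr_ge0// => s _.
  by rewrite mulr_ge0// ffunE sumr_ge0// => s' _; rewrite mulr_ge0// sqr_ge0.
have stepB h y : carre (q * h) y <= (q * carre h) y.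
  rewrite convE; under [leRHS]eq_bigr do rewrite ffunE mulr_sumr.
  rewrite exchange_big /= ffunE; apply: ler_sum => s _.
  under eq_bigr do rewrite mulrCA.
  rewrite -mulr_sumr ler_wpM2l// !convE -sumrB.
  under eq_bigr do rewrite -mulrBr [y - s - _]addrAC.
  exact: jensen_sqr.
elim: n g x => [|n IH] g x.
  by rewrite !expr0 !mul1r ffunE subrr !mul0r.
have IHq := IH (q * g) x.
have h1 : (q ^+ n * (q * sqf g)) x - (q ^+ n * sqf (q * g)) x <=
    a * (q ^+ n.+1 * carre g) x.
  rewrite -sub_alg_coef -mulrBr exprSr -mulrA -scale_alg_coef scalerAr.
  apply: conv_le => // y; rewrite sub_alg_coef scale_alg_coef [sqf _ y]ffunE.
  exact: stepA.
have h2 : n%:R * a * (q ^+ n * carre (q * g)) x <= n%:R * a * (q ^+ n.+1 * carre g) x.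
  rewrite ler_wpM2l ?mulr_ge0// exprSr -mulrA; exact: conv_le.
rewrite -[n.+1%:R]natr1 !mulrDl mul1r.
have -> : q ^+ n.+1 * sqf g = q ^+ n * (q * sqf g) by rewrite exprSr mulrA.
have -> : q ^+ n.+1 * g = q ^+ n * (q * g) by rewrite exprSr mulrA.
by lra.
Qed.

Lemma heat_local_poincare t g x : 0 <= t ->
  (heat t * sqf g) x - (heat t * g) x ^+ 2 <= t * (heat t * carre g) x.
Proof.
move=> t0.
(* The Euler step is rescaled to mass one, as the variance argument requires; the n-th power of the
   scaling factor tends to 1. *)
pose q n : A := (1 + t / n%:R)^-1 *: (1 + (t / n%:R) *: kap).
have qc y : (q n ^+ n) y @[n --> \oo] --> heat t y.
  have -> : (fun n => (q n ^+ n) y) =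
      (fun n => (expR (- t) * (1 + t / n%:R) ^+ n)^-1 * euler t n y).
    apply/funext => n; rewrite /q /euler_heat exprZn !scale_alg_coef exprVn.
    by rewrite invfM mulrACA mulVf ?mul1r// gt_eqF// expR_gt0.
  rewrite -[X in _ --> X]mul1r; apply: cvgM; last exact: euler_heat_cvg.
  by rewrite -[X in _ --> X]invr1; apply: cvgV; [exact: oner_neq0|exact: mass_euler_cvg].
have hc (h : A) : (q n ^+ n * h) x @[n --> \oo] --> (heat t * h) x.
  by apply: cvg_conv => y; [exact: qc|exact: cvg_cst].
have hl : (q n ^+ n * sqf g) x - (q n ^+ n * g) x * (q n ^+ n * g) x @[n --> \oo] -->
   (heat t * sqf g) x - (heat t * g) x * (heat t * g) x.
  by apply: cvgB => //; apply: cvgM.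
have hr : t * (q n ^+ n * carre g) x @[n --> \oo] --> t * (heat t * carre g) x.
  exact: cvgMl_tmp.
rewrite expr2; apply: (ler_cvg_to hl hr); near=> n.
have n0 : (0 < n)%N by near: n; exact: nbhs_infty_gt.
have a0 : 0 <= t / n%:R by rewrite divr_ge0.
have := lazy_local_poincare n g x a0 (erefl (q n)); rewrite expr2.
by rewrite [n%:R * _]mulrC mulfVK// pnatr_eq0 -lt0n.
Unshelve. all: by end_near. Qed.

End HeatSemigroup.

(** * Mixing time estimates *)

Lemma ln_sqr_le4 (R : realType) (x : R) : 1 <= x -> ln x ^+ 2 <= 4 * x.
Proof.
move=> x1; have x0 : 0 < x by apply: lt_le_trans x1.
have s0 : 0 < Num.sqrt x by rewrite sqrtr_gt0.
have -> : ln x = 2 * ln (Num.sqrt x).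
  by rewrite -{1}(sqr_sqrtr (ltW x0)) lnXn// mulr_natl.
have h1 : 0 <= ln (Num.sqrt x).
  by rewrite ln_ge0// -sqrtr1 ler_sqrt ?(ltW x0).
have h2 : ln (Num.sqrt x) <= Num.sqrt x by rewrite ltW// ln_sublinear.
rewrite exprMn -[in leRHS](sqr_sqrtr (ltW x0)) -natrX ler_wpM2l//.
by rewrite lerXn2r// nnegrE // ltW.
Qed.

(** For a ratio r of neighbouring masses: r >= 1 is controlled by r itself, while for r < 1 the
    lower bound r >= 1 / (M v) limits how negative ln r can be. All terms of the bound are
    integrable against the heat kernel. *)
Lemma ln_sqr_le (R : realType) (r M v : R) : 0 < r -> 1 <= M -> 0 < v ->
  1 <= r * (M * v) -> ln r ^+ 2 <= 4 * r + 2 * ln M ^+ 2 + 8 * v.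
Proof.
move=> r0 M1 v0 h.
have lM : 0 <= ln M by rewrite ln_ge0.
have M0 : 0 < M by apply: lt_le_trans M1.
have sM : 0 <= ln M ^+ 2 by rewrite sqr_ge0.
have [r1|r1] := leP 1 r; first by have := ln_sqr_le4 r1; lra.
have lr : ln r <= 0 by rewrite ln_le0// ltW.
have : 0 <= ln (r * (M * v)) by rewrite ln_ge0.
rewrite !lnM ?posrE ?mulr_gt0// => h1.
have [v1|v1] := leP 1 v.
  have h2 := ln_sqr_le4 v1.
  have : ln r ^+ 2 <= (ln M + ln v) ^+ 2.
    rewrite -sqrrN lerXn2r// ?nnegrE; first by rewrite oppr_ge0.
      by rewrite addr_ge0// ln_ge0.
    by lra.
  by have := sqr_ge0 (ln M - ln v); rewrite sqrrB sqrrD; lra.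
have lv : ln v <= 0 by rewrite ln_le0// ltW.
have : ln r ^+ 2 <= ln M ^+ 2.
  by rewrite -sqrrN lerXn2r// ?nnegrE//; [rewrite oppr_ge0|lra].
by lra.
Qed.

Section MixingEstimates.
Variables (R : realType) (X : finZmodType) (S : {set X}).
Local Notation A := (group_algebra R X).
Hypothesis S0 : (0 < #|S|)%N.
Hypothesis symS : forall s, s \in S -> - s \in S.
Implicit Types (f g h : A) (x y s : X) (t : R) (E : {set X}).
Local Notation kap := (step_law R S).
Local Notation heat := (@heat R X S).
Local Notation hp := (@heat_partial R X S).
Local Notation N := (#|X|%:R : R).

Let N0 : 0 < N.
Proof. by rewrite ltr0n; apply/card_gt0P; exists 0. Qed.

Lemma star_step_law : star kap = kap.
Proof.
apply/ffunP => x; rewrite starE !ffunE; congr (_ * (nat_of_bool _)%:R).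
by apply/idP/idP => /symS; rewrite ?opprK.
Qed.

Lemma heatN t x : heat t (- x) = heat t x.
Proof.
rewrite !ffunE /heat_kernel.
suff -> : (fun k => walk_power R S k 0 (- x) * t ^+ k / k`!%:R) =
          (fun k => walk_power R S k 0 x * t ^+ k / k`!%:R) by [].
by apply/funext => k; rewrite !walk_powerE// !subr0 -starE starX star_step_law.
Qed.

Lemma step_lawX_shift k x s : s \in S -> (kap ^+ k) x <= #|S|%:R * (kap ^+ k.+1) (x + s).
Proof.
move=> sS; rewrite exprS convE (bigD1 s)//= addrK ffunE sS mulr1 mulrDr mulrA.
rewrite divff ?pnatr_eq0 -?lt0n// mul1r lerDl mulr_ge0// sumr_ge0// => y _.
by rewrite mulr_ge0 ?step_law_ge0 ?step_lawX_ge0.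
Qed.

(** The weight t^j / j! times j / t is the weight of index j - 1, so the mean number of steps turns
    into one extra convolution with [kap]; truncation only loses a nonnegative term. *)
Lemma heat_partial_moment t m x : 0 < t ->
  \sum_(0 <= j < m) (t ^+ j / j`!%:R) * (j%:R / t) * (kap ^+ j) x <= (kap * hp t m) x.
Proof.
move=> t0; have hE : (kap * hp t m) x =
    \sum_(0 <= j < m) (t ^+ j / j`!%:R) * (kap ^+ j.+1) x.
  rewrite /heat_partial mulr_sumr algE; apply: eq_bigr => j _.
  by rewrite -scalerAr -exprS algE.
have t0' : 0 <= t := ltW t0.
rewrite hE; case: m {hE} => [|m]; first by rewrite !big_nil.
rewrite big_nat_recl// mul0r mulr0 mul0r add0r big_nat_recr//=.
apply: (@le_trans _ _ (\sum_(0 <= j < m) (t ^+ j / j`!%:R) * (kap ^+ j.+1) x)).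
  apply: ler_sum => j _; rewrite le_eqVlt; apply/orP; left; apply/eqP.
  congr (_ * _); rewrite factS natrM exprS; field.
  by rewrite (gt_eqF t0) nat1r !pnatr_eq0 -lt0n fact_gt0.
by rewrite lerDl mulr_ge0 ?step_lawX_ge0// divr_ge0// exprn_ge0.
Qed.

(* Appending the step [s] to a path of [j] steps changes its weight by the
   factor [t / (j + 1)], bounded below through [1 / u >= 2 c - c^2 u]; the mean
   of [j] given the position of the walk is controlled by [kap * heat t]. *)
Lemma heat_shift t x s (c : R) : 0 < t -> s \in S ->
  2 * c * heat t x - c ^+ 2 * ((kap * heat t) x + heat t x / t) <=
  #|S|%:R * heat t (x + s).
Proof.
move=> t0 sS; have t0' : 0 <= t := ltW t0.
have key m : 2 * c * hp t m x - c ^+ 2 * ((kap * hp t m) x + hp t m x / t) <=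
    #|S|%:R * hp t m.+1 (x + s).
  pose w j : R := t ^+ j / j`!%:R.
  have w0 j : 0 <= w j by rewrite divr_ge0// exprn_ge0.
  apply: (@le_trans _ _ (\sum_(0 <= j < m) w j * (t / j.+1%:R) * (kap ^+ j) x)).
    apply: (@le_trans _ _ (\sum_(0 <= j < m)
        (w j * (2 * c - c ^+ 2 * (j.+1%:R / t)) * (kap ^+ j) x))).
      have := heat_partial_moment m x t0.
      set q := \sum_(0 <= j < m) _ => hq.
      have -> : \sum_(0 <= j < m) (w j * (2 * c - c ^+ 2 * (j.+1%:R / t)) * (kap ^+ j) x) =
          2 * c * hp t m x - c ^+ 2 * (q + hp t m x / t).
        rewrite /q heat_partialE mulr_suml mulrDr !mulr_sumr -big_split -sumrB.
        by apply: eq_bigr => j _; rewrite /= -natr1 -/(w j); ring.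
      rewrite lerD2l lerN2 ler_wpM2l ?sqr_ge0// lerD2r//.
    apply: ler_sum => j _; rewrite ler_wpM2r ?step_lawX_ge0// ler_wpM2l//.
    set u := j.+1%:R / t; have u0 : 0 < u by rewrite divr_gt0// ltr0n.
    have -> : t / j.+1%:R = u^-1 by rewrite invf_div.
    rewrite -subr_ge0.
    have -> : u^-1 - (2 * c - c ^+ 2 * u) = u^-1 * (1 - c * u) ^+ 2.
      by field; rewrite gt_eqF.
    by rewrite mulr_ge0 ?sqr_ge0// invr_ge0 ltW.
  rewrite heat_partialE big_nat_recl// mulrDr -[leLHS]add0r; apply: lerD.
    by rewrite mulr_ge0// mulr_ge0 ?step_lawX_ge0// divr_ge0.
  rewrite mulr_sumr; apply: ler_sum => j _.
  have -> : w j * (t / j.+1%:R) = t ^+ j.+1 / (j.+1)`!%:R.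
    by rewrite /w factS natrM exprS; field; rewrite nat1r !pnatr_eq0 -lt0n fact_gt0.
  rewrite mulrCA ler_wpM2l ?step_lawX_shift//.
  by rewrite divr_ge0// exprn_ge0.
have hpc y : (expR (- t) *: hp t m) y @[m --> \oo] --> heat t y.
  under eq_fun do rewrite scale_alg_coef.
  exact: heat_partial_cvg.
have hpk : (kap * (expR (- t) *: hp t m)) x @[m --> \oo] --> (kap * heat t) x.
  by apply: cvg_conv => y; [exact: cvg_cst|exact: hpc].
have hr : #|S|%:R * (expR (- t) *: hp t m.+1) (x + s) @[m --> \oo] -->
    #|S|%:R * heat t (x + s).
  apply: cvgMl_tmp; have := hpc (x + s).
  by rewrite -(cvg_shiftS (fun m => (expR (- t) *: hp t m) (x + s))).
have hl : 2 * c * (expR (- t) *: hp t m) x -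
    c ^+ 2 * ((kap * (expR (- t) *: hp t m)) x + (expR (- t) *: hp t m) x / t) @[m --> \oo] -->
    2 * c * heat t x - c ^+ 2 * ((kap * heat t) x + heat t x / t).
  apply: cvgB; first by apply: cvgMl_tmp; exact: hpc.
  apply: cvgMl_tmp; apply: cvgD => //; apply: cvgMr_tmp; exact: hpc.
apply: (ler_cvg_to hl hr); near=> m.
rewrite -scalerAr !scale_alg_coef.
have := key m; rewrite -(ler_pM2l (expR_gt0 (- t))).
by congr (_ <= _); ring.
Unshelve. all: by end_near. Qed.

End MixingEstimates.

(** * Varentropy, lower bound on the mixing time, and window *)

Section MixingBounds.
Variables (R : realType) (X : finZmodType) (S : {set X}).
Local Notation A := (group_algebra R X).
Hypothesis S0 : (0 < #|S|)%N.
Hypothesis symS : forall s, s \in S -> - s \in S.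
Implicit Types (f g h : A) (x y s : X) (t : R) (E : {set X}).
Local Notation kap := (step_law R S).
Local Notation heat := (@heat R X S).
Local Notation hp := (@heat_partial R X S).
Local Notation N := (#|X|%:R : R).

Let N0 : 0 < N.
Proof. by rewrite ltr0n; apply/card_gt0P; exists 0. Qed.

(** [ln_sqr_le] is applied to each edge. Multiplied by [heat t x] and summed over x, the ratio and
    the correction v become total masses, which leaves 4 + 2 (ln |S|)^2 + 8 (1 + 1 / t). *)
Lemma log_gradient_le t (a : R) : 0 < a -> 1 <= t ->
  \sum_x heat t x * carre S ([ffun y => ln (a * heat t y)] : A) x
    <= 20 + 2 * ln #|S|%:R ^+ 2.
Proof.
move=> a0 t1; have t0 : 0 < t by apply: lt_le_trans t1.
have m0 y : 0 <= heat t y by rewrite heat_ge0 // ltW.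
have k0 y : 0 <= kap y by rewrite step_law_ge0.
set la := ln #|S|%:R.
have cS : 0 < #|S|%:R :> R by rewrite ltr0n.
pose b x s := 4 * heat t (x - s) + 2 * la ^+ 2 * heat t x +
   8 * ((kap * heat t) x + heat t x / t).
have kh0 y : 0 <= (kap * heat t) y by apply: conv_ge0.
have b0 x s : 0 <= b x s.
  have kt0 : 0 <= (kap * heat t) x + heat t x / t by rewrite addr_ge0// divr_ge0// ltW.
  rewrite /b; apply: addr_ge0; last by rewrite mulr_ge0.
  by apply: addr_ge0; rewrite mulr_ge0// mulr_ge0// sqr_ge0.
have key x s : s \in S ->
    heat t x * (ln (a * heat t (x - s)) - ln (a * heat t x)) ^+ 2 <= b x s.
  move=> sS; have [->|hx] := eqVneq (heat t x) 0; first by rewrite mul0r.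
  have hxp : 0 < heat t x by rewrite lt_neqAle eq_sym hx m0.
  set v := ((kap * heat t) x + heat t x / t) / heat t x.
  have v0 : 0 < v by rewrite divr_gt0// ltr_wpDl// divr_gt0.
  (* The choice c = 1 / v maximises 2 c - c^2 v in the bound of [heat_shift]. Symmetry of S supplies
     the step to x - s. *)
  have h := heat_shift S0 x v^-1 t0 (symS sS).
  have hr : 1 <= heat t (x - s) / heat t x * (#|S|%:R * v).
    move: h; rewrite -[(kap * heat t) x + heat t x / t](divfK hx) -/v.
    have -> : 2 / v * heat t x - v^-1 ^+ 2 * (v * heat t x) = heat t x / v.
      by field; rewrite gt_eqF.
    rewrite ler_pdivrMr// -[X in X <= _]mul1r -ler_pdivlMr// => h.
    by apply: (le_trans h); rewrite le_eqVlt; apply/orP; left; apply/eqP; ring.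
  have rp : 0 < heat t (x - s) / heat t x.
    rewrite lt_neqAle divr_ge0// andbT; apply/eqP => r0; move: hr.
    by rewrite -r0 mul0r ler10.
  have hsp : 0 < heat t (x - s) by move: rp; rewrite pmulr_lgt0// invr_gt0.
  rewrite !lnM ?posrE// opprD addrACA subrr add0r.
  have -> : ln (heat t (x - s)) - ln (heat t x) = ln (heat t (x - s) / heat t x).
    by rewrite lnM ?posrE ?invr_gt0// lnV ?posrE.
  apply: (@le_trans _ _ (heat t x * (4 * (heat t (x - s) / heat t x) + 2 * la ^+ 2 + 8 * v))).
    by rewrite ler_wpM2l// ln_sqr_le// ler1n.
  rewrite /b /v le_eqVlt; apply/orP; left; apply/eqP; field.
  by rewrite hx gt_eqF.
apply: (@le_trans _ _ (\sum_x \sum_s kap s * b x s)).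
  apply: ler_sum => x _; rewrite [carre S _ x]ffunE mulr_sumr; apply: ler_sum => s _.
  rewrite mulrCA; have [sS|sS] := boolP (s \in S); last first.
    by rewrite [kap s]ffunE (negbTE sS) mulr0 !mul0r.
  have gE y : ([ffun y => ln (a * heat t y)] : A) y = ln (a * heat t y) by rewrite ffunE.
  by rewrite ler_wpM2l// !gE key.
have -> : \sum_x \sum_s kap s * b x s = 4 + 2 * la ^+ 2 + 8 * (1 + t^-1).
  rewrite exchange_big /=.
  have mh := mass_heat S0 (ltW t0).
  have mk := mass_step_law R S0.
  have hs s : \sum_x b x s = 4 + 2 * la ^+ 2 + 8 * (1 + t^-1).
    rewrite /b !big_split /= -!mulr_sumr big_split /= -mulr_suml.
    rewrite -/(mass (heat t)) -/(mass (kap * heat t)) massM mh mk !mul1r mulr1.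
    rewrite (reindex_inj (addIr s)) /=; under eq_bigr do rewrite addrK.
    by rewrite -/(mass (heat t)) mh mulr1.
  under eq_bigr do rewrite -mulr_sumr hs.
  by rewrite -mulr_suml -/(mass kap) mk mul1r.
have : t^-1 <= 1 by rewrite invf_le1.
by lra.
Qed.

(** Points reached in fewer than r steps; the ball of index 0 is empty, so its complement
    corresponds to at least r steps. *)
Fixpoint ball (r : nat) : {set X} :=
  if r is r'.+1 then (0 |: [set s + y | s in S, y in ball r'])%SET else finset.set0.

Lemma card_ball r : (#|ball r| <= #|S|.+1 ^ r)%N.
Proof.
elim: r => [|r IH]; first by rewrite /= cards0.
rewrite /= (leq_trans (leq_card_setU _ _))// cards1 expnS mulSn.
rewrite leq_add ?expn_gt0//.
by rewrite curry_imset2X (leq_trans (leq_imset_card _ _))// cardsX leq_mul.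
Qed.

Lemma step_lawX_ball r j x : (j < r)%N -> x \notin ball r -> (kap ^+ j) x = 0.
Proof.
elim: r j x => [|r IH] [|j] x //= jr; rewrite in_setU1 negb_or => /andP[x0 xS].
  by rewrite expr0 one_alg_coef (negbTE x0).
rewrite exprS convE big1// => y _.
have [yS|yS] := boolP (y \in S); last by rewrite ffunE (negbTE yS) mulr0 mul0r.
rewrite IH ?mulr0//; apply: contra xS => xyb.
by apply/imset2P; exists y (x - y) => //; rewrite addrC subrK.
Qed.

(** The number of steps made by time t is Poisson of mean t, and leaving the ball takes at least r
    of them: Markov's inequality. *)
Lemma heat_ball t r : 0 <= t -> (0 < r)%N ->
  \sum_(x | x \notin ball r) heat t x <= t / r%:R.
Proof.
move=> t0 r0; have rp : 0 < r%:R :> R by rewrite ltr0n.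
have hc : \sum_(x | x \notin ball r) expR (- t) * hp t m x @[m --> \oo] -->
    \sum_(x | x \notin ball r) heat t x.
  rewrite big_mkcond /=; under eq_fun do rewrite big_mkcond /=.
  apply: cvg_sum_fin => x; case: ifP => _; last exact: cvg_cst.
  exact: heat_partial_cvg.
apply: (cvgr_to_le hc); near=> m.
have m0 : (0 < m)%N by near: m; exact: nbhs_infty_gt.
rewrite -mulr_sumr expRN ler_pdivrMl ?expR_gt0//.
apply: (@le_trans _ _ (\sum_(0 <= j < m) t ^+ j / j`!%:R * (j%:R / r%:R))).
  under eq_bigr do rewrite heat_partialE.
  rewrite exchange_big /=; apply: ler_sum => j _; rewrite -mulr_sumr ler_wpM2l//.
    by rewrite divr_ge0// exprn_ge0.
  have [jr|rj] := ltnP j r.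
    by rewrite big1 ?divr_ge0// => x xb; exact: step_lawX_ball xb.
  apply: (@le_trans _ _ 1); last by rewrite ler_pdivlMr// mul1r ler_nat.
  rewrite -(mass_step_lawX R S0 j) /mass big_mkcond /=; apply: ler_sum => x _.
  by case: ifP => // _; rewrite step_lawX_ge0.
rewrite -(prednK m0) big_nat_recl// mul0r mulr0 add0r.
apply: (@le_trans _ _ (t / r%:R * \sum_(0 <= j < m.-1) t ^+ j / j`!%:R)).
  rewrite mulr_sumr; apply: ler_sum => j _; rewrite le_eqVlt; apply/orP; left; apply/eqP.
  rewrite factS natrM exprS; field.
  by rewrite nat1r !pnatr_eq0 -!lt0n fact_gt0 r0.
by rewrite mulrC ler_wpM2r ?divr_ge0// big_mkord sum_fact_le_expR.
Unshelve. all: by end_near. Qed.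

Lemma worst_tv_event t (v : R) E : worst_tv S t <= v ->
  `|\sum_(y in E) heat t y - #|E|%:R / N| <= v.
Proof.
move=> h; apply: le_trans h.
apply: (@le_trans _ _ (tv_dist (heat_kernel S t 0) (uniform_law R (X := X)))); last first.
  by apply: (le_bigmax _ (fun x => tv_dist (heat_kernel S t x) (uniform_law R (X := X)))).
apply: (@le_trans _ _ (`|\sum_(y in E) heat_kernel S t 0 y - \sum_(y in E) uniform_law R y|)); last first.
  by apply: (le_bigmax _ (fun E : {set X} =>
    `|\sum_(y in E) heat_kernel S t 0 y - \sum_(y in E) uniform_law R y|)).
rewrite le_eqVlt; apply/orP; left; apply/eqP; congr (`|_ - _|).
  by apply: eq_bigr => y _; rewrite ffunE.
by rewrite /uniform_law sumr_const -[RHS]mulr_natl.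
Qed.

(** By translation invariance, moving the event replaces any starting point by 0. *)
Lemma worst_tv_le t (v : R) : 0 <= v ->
  (forall E, `|\sum_(y in E) heat t y - #|E|%:R / N| <= v) -> worst_tv S t <= v.
Proof.
move=> v0 h; apply/bigmax_leP; split=> // x _; apply/bigmax_leP; split=> // E _.
have := h [set y - x | y in E]%SET; rewrite card_imset; last exact: addIr.
congr (`|_ - _| <= _).
  rewrite big_imset /=; last by move=> ? ? _ _; apply: addIr.
  by apply: eq_bigr => y _; rewrite heat_kernelE.
by rewrite /uniform_law sumr_const -[RHS]mulr_natl.
Qed.

(** The ball has uniform mass at most e / 2, so its heat mass is at most 1 - e / 2; the remaining e
    / 2 lies outside, where [heat_ball] allows only t / r. *)
Lemma mixing_lower t (e : R) r : 0 <= t -> (0 < r)%N ->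
  #|S|.+1%:R ^+ r / N <= e / 2 -> worst_tv S t <= 1 - e -> e / 2 * r%:R <= t.
Proof.
move=> t0 r0 hr /(worst_tv_event (ball r)) h.
have h1 := heat_ball t0 r0.
have h2 : #|ball r|%:R / N <= e / 2.
  apply: le_trans hr; rewrite ler_wpM2r ?invr_ge0 ?(ltW N0)// -natrX ler_nat.
  exact: card_ball.
have h3 : \sum_(y in ball r) heat t y + \sum_(y | y \notin ball r) heat t y = 1.
  by rewrite -(mass_heat S0 t0) /mass [RHS](bigID (mem (ball r))).
have h4 : \sum_(y in ball r) heat t y - #|ball r|%:R / N <= 1 - e.
  by apply: le_trans h; rewrite ler_norm.
rewrite -ler_pdivlMr ?ltr0n//; lra.
Qed.

Section WithGap.
Variable c : R.
Hypothesis gap : forall f, mass f = 0 -> c * dot f f <= dot f f - dot (kap * f) f.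

(** L2 decay would be ruined by a few points of high density, so the mass off G is set aside. On G
    the density is at most M, the centred part has squared norm at most M / N, and Cauchy-Schwarz
    against an event costs a factor N. *)
Lemma smoothing t u (e M : R) (G : {set X}) : 0 <= t -> 0 <= u -> 0 <= e -> 0 <= M ->
  \sum_(x | x \notin G) heat t x <= e / 2 ->
  (forall x, x \in G -> N * heat t x <= M) ->
  expR (- (2 * u * c)) * M <= (e / 2) ^+ 2 -> worst_tv S (t + u) <= e.
Proof.
move=> t0 u0 e0 M0 hB hG hM; apply: worst_tv_le => // E.
have m0 y : 0 <= heat t y by rewrite heat_ge0.
have u00 y : 0 <= heat u y by rewrite heat_ge0.
pose mG : A := [ffun x => if x \in G then heat t x else 0].
pose mB : A := [ffun x => if x \in G then 0 else heat t x].
pose cs : A := [ffun=> N^-1].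
have tE : heat t = mG + mB.
  by apply/ffunP => x; rewrite algE [mG x]ffunE [mB x]ffunE; case: ifP => _; rewrite ?addr0 ?add0r.
have mB0 y : 0 <= mB y by rewrite ffunE; case: ifP.
have mG0 y : 0 <= mG y by rewrite ffunE; case: ifP.
have mBE : mass mB = \sum_(x | x \notin G) heat t x.
  by rewrite /mass [RHS]big_mkcond; apply: eq_bigr => x _; rewrite ffunE if_neg.
have mcs : mass cs = 1.
  by rewrite /mass; under eq_bigr do rewrite ffunE; rewrite sumr_const -[_ *+ _]mulr_natl divff ?gt_eqF.
have mtot : mass mG + mass mB = 1 by rewrite -massD -tE mass_heat.
pose v := mG - mass mG *: cs.
have mv : mass v = 0 by rewrite /v massD -scaleN1r massZ massZ mcs mulr1 mulN1r subrr.
have ucs : heat u * cs = cs.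
  apply/ffunP => x; rewrite convE; under eq_bigr do rewrite [cs _]ffunE.
  by rewrite -mulr_suml -/(mass _) mass_heat// mul1r ffunE.
have dv : dot v v <= M / N.
  have dGc : dot mG cs = mass mG / N.
    by rewrite dotE; under eq_bigr do rewrite [cs _]ffunE; rewrite -mulr_suml.
  have dcc : dot cs cs = N^-1.
    by rewrite dotE; under eq_bigr do rewrite [X in _ * X]ffunE; rewrite -mulr_suml -/(mass cs) mcs mul1r.
  have -> : dot v v = dot mG mG - mass mG ^+ 2 / N.
    by rewrite /v dot_subZ dGc dcc; ring.
  apply: (@le_trans _ _ (dot mG mG)).
    by rewrite lerBlDr lerDl divr_ge0 ?sqr_ge0// ltW.
  apply: (@le_trans _ _ (\sum_x heat t x * (M / N))); last first.
    rewrite -mulr_suml -/(mass _) mass_heat// mul1r//.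
  rewrite dotE; apply: ler_sum => x _; rewrite ffunE; case: ifP => xG.
    by rewrite ler_wpM2l// ler_pdivlMr// mulrC hG.
  by rewrite mul0r mulr_ge0// divr_ge0 ?(ltW N0).
pose iE : A := [ffun x => (x \in E)%:R].
have sumE f : \sum_(y in E) f y = dot iE f.
  by rewrite dotE big_mkcond; apply: eq_bigr => y _; rewrite ffunE; case: ifP; rewrite ?mul1r ?mul0r.
have hv : `|\sum_(y in E) (heat u * v) y| <= e / 2.
  have e20 : 0 <= e / 2 by rewrite divr_ge0.
  rewrite -(ler_pXn2r (ltn0Sn 1)) ?nnegrE// -normrX ger0_norm ?sqr_ge0//.
  rewrite sumE; apply: le_trans (dot_CS _ _) _.
  have iN : dot iE iE <= N.
    rewrite dotE -[leRHS]mulr_natl mulr1 -sumr_const; apply: ler_sum => x _.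
    by rewrite ffunE; case: (_ \in _); rewrite ?mulr1 ?mulr0.
  apply: (@le_trans _ _ (N * (expR (- (2 * u * c)) * (M / N)))).
    apply: ler_pM; rewrite ?dot_ge0//; apply: le_trans (heat_decay S0 gap u0 mv) _.
    by rewrite ler_wpM2l ?expR_ge0.
  by apply: le_trans hM; rewrite le_eqVlt; apply/orP; left; apply/eqP; field; rewrite gt_eqF.
have hsplit : \sum_(y in E) heat (t + u) y - #|E|%:R / N =
    \sum_(y in E) (heat u * v) y +
    (\sum_(y in E) (heat u * mB) y - mass mB * (#|E|%:R / N)).
  have csE : \sum_(y in E) cs y = #|E|%:R / N.
    by under eq_bigr do rewrite ffunE; rewrite sumr_const -[LHS]mulr_natl.
  have -> : heat (t + u) = heat u * v + mass mG *: cs + heat u * mB.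
    rewrite (addrC t) heatD// tE mulrDr; congr (_ + _).
    by rewrite -[in RHS]ucs scalerAr -mulrDr /v subrK.
  under eq_bigr do rewrite !add_alg_coef scale_alg_coef.
  rewrite !big_split /= -mulr_sumr csE.
  have -> : mass mG = 1 - mass mB by rewrite -mtot addrK.
  ring.
(* The discarded mass and its uniform counterpart both lie in [0, [mass mB]], so their difference
   costs e / 2, not e. *)
have hb1 : 0 <= \sum_(y in E) (heat u * mB) y <= mass mB.
  have uB y : 0 <= (heat u * mB) y by apply: conv_ge0.
  apply/andP; split; first exact: sumr_ge0.
  rewrite -[leRHS]mul1r -(mass_heat S0 u0) -massM /mass big_mkcond.
  by apply: ler_sum => y _; case: ifP.
have hb2 : 0 <= mass mB * (#|E|%:R / N) <= mass mB.
  have mB00 : 0 <= mass mB by apply: sumr_ge0.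
  rewrite mulr_ge0 ?divr_ge0 ?(ltW N0)//= -[leRHS]mulr1 ler_wpM2l//.
  by rewrite ler_pdivrMr// mul1r ler_nat max_card.
rewrite hsplit; apply: le_trans (ler_normD _ _) _.
have : `|\sum_(y in E) (heat u * mB) y - mass mB * (#|E|%:R / N)| <= e / 2.
  by move: hb1 hb2 hB; rewrite -mBE ler_norml => /andP[? ?] /andP[? ?] ?; lra.
by lra.
Qed.

(** Keeps the infimum in [mixing_time] off its default value. It suffices to smooth with G
    everything and the trivial density bound N. *)
Lemma mixing_set_nonempty (e : R) : 0 < e -> 0 < c -> exists2 t : R, 0 <= t & worst_tv S t <= e.
Proof.
move=> e0 c0; pose u : R := ln (N / (e / 2) ^+ 2) / (2 * c).
have q0 : 0 < (e / 2) ^+ 2 by rewrite exprn_gt0// divr_gt0.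
pose u' := Num.max 0 u.
have u0 : 0 <= u' by rewrite le_max lexx.
exists (1 + u'); first by rewrite addr_ge0.
apply: (@smoothing 1 u' e N [set: X]%SET) => //; rewrite ?(ltW e0) ?(ltW N0)//.
- by rewrite big1 ?divr_ge0 ?(ltW e0)// => x; rewrite inE.
- move=> x _; rewrite -[leRHS]mulr1 ler_wpM2l ?(ltW N0)//.
  have := @coef_le_mass _ _ (heat 1) x.
  by rewrite mass_heat//; apply => y; rewrite heat_ge0.
have : ln (N / (e / 2) ^+ 2) <= 2 * u' * c.
  have : u <= u' by rewrite le_max lexx orbT.
  rewrite /u ler_pdivrMr ?mulr_gt0//; lra.
rewrite -ler_expR lnK ?posrE ?divr_gt0// ler_pdivrMr// expRN => h.
by rewrite ler_pdivrMl ?expR_gt0.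
Qed.

(** Concentration of the log-density g about its mean D, within [th], is combined with an upper
    bound on D: a law at distance at most 1 - e from uniform cannot sit on a very small set. Then
    [smoothing] applies. *)
Lemma mixing_window t u (e : R) : 0 < e -> e < 1 -> 1 <= t -> 0 <= u ->
  2 * Num.sqrt (2 * t * (20 + 2 * ln #|S|%:R ^+ 2) / e) + ln (8 / e ^+ 3) <= 2 * u * c ->
  worst_tv S t <= 1 - e -> worst_tv S (t + u) <= e.
Proof.
move=> e0 e1 t1 u0 hu htv.
have t0 : 0 < t by apply: lt_le_trans t1.
have m0 y : 0 <= heat t y by rewrite heat_ge0 // ltW.
set W := 20 + 2 * ln #|S|%:R ^+ 2 in hu.
have W0 : 0 < W by rewrite /W; have := sqr_ge0 (ln (#|S|%:R : R)); lra.
(* Chebyshev's inequality with variance at most t W: this deviation is exceeded with probability at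
   most e / 2. *)
set th := Num.sqrt _ in hu.
have th2 : th ^+ 2 = 2 * t * W / e.
  by rewrite sqr_sqrtr// ltW// divr_gt0// !mulr_gt0.
have th0 : 0 < th by rewrite sqrtr_gt0 divr_gt0// !mulr_gt0.
pose g : A := [ffun y => ln (N * heat t y)].
have gE x : g x = ln (N * heat t x) by rewrite [g x]ffunE.
have gN x : g (- x) = g x by rewrite !gE heatN.
(* The local Poincare inequality at 0 concerns the walk reflected through 0; since S is symmetric, g
   is even and the reflection disappears. *)
have flip (f : A) : (forall x, f (- x) = f x) -> (heat t * f) 0 = \sum_y heat t y * f y.
  by move=> fN; rewrite convE; apply: eq_bigr => y _; rewrite sub0r fN.
set D := \sum_y heat t y * g y.
have mh := mass_heat S0 (ltW t0).
have hV : \sum_y heat t y * (g y - D) ^+ 2 <= t * W.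
  rewrite (second_momentE mh) -/D.
  have := @heat_local_poincare _ _ S S0 t g 0 (ltW t0).
  rewrite (flip g)// -/D.
  rewrite (flip (sqf g)); last by move=> x; rewrite ![sqf g _]ffunE gN.
  have -> : (heat t * carre S g) 0 = \sum_x heat t x * carre S g x.
    rewrite convE (reindex_inj (@oppr_inj X)) /=; apply: eq_bigr => x _.
    by rewrite sub0r opprK heatN.
  have hW : t * \sum_x heat t x * carre S g x <= t * W.
    by rewrite ler_wpM2l ?(ltW t0)//; exact: log_gradient_le.
  have -> : \sum_y heat t y * sqf g y = \sum_y heat t y * g y ^+ 2.
    by apply: eq_bigr => y _; rewrite [sqf g y]ffunE.
  lra.
(* Positivity is required separately, because at a point of mass zero the logarithm is a default
   value and carries no information. *)
pose G : {set X} := [set x | (`|g x - D| <= th) && (0 < heat t x)]%SET.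
have hB : \sum_(x | x \notin G) heat t x <= e / 2.
  have : \sum_(x | x \notin G) heat t x * th ^+ 2 <= t * W.
    apply: le_trans hV; rewrite big_mkcond /=; apply: ler_sum => x _.
    case: ifP => [|_]; last by rewrite mulr_ge0 ?sqr_ge0.
    rewrite inE negb_and -!ltNge -leNgt => /orP[hx|hx].
      by rewrite ler_wpM2l// -[(_ - _) ^+ 2]real_normK ?num_real// lerXn2r ?nnegrE ?(ltW th0) ?(ltW hx).
    have -> : heat t x = 0 by apply/eqP; rewrite eq_le hx m0.
    by rewrite !mul0r.
  rewrite -mulr_suml -ler_pdivlMr ?exprn_gt0// th2.
  have -> : t * W / (2 * t * W / e) = e / 2 by field; rewrite !gt_eqF.
  by [].
have hG x : x \in G -> expR (D - th) <= N * heat t x <= expR (D + th).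
  rewrite inE ler_distl => /andP[/andP[h1 h2] hx]; rewrite gE in h1 h2.
  have Nh : 0 < N * heat t x by rewrite mulr_gt0.
  by rewrite -[N * heat t x]lnK ?posrE// !ler_expR h1 h2.
(* G has heat mass at least 1 - e / 2, hence uniform mass at least e / 2; the density on G is at
   least exp(D - th), hence this uniform mass is at most exp(th - D). *)
have hD : e / 2 <= expR (th - D).
  have h1 := worst_tv_event G htv.
  have h2 : \sum_(y in G) heat t y + \sum_(y | y \notin G) heat t y = 1.
    by rewrite -mh /mass [RHS](bigID (mem G)).
  have h3 : \sum_(y in G) heat t y - #|G|%:R / N <= 1 - e.
    by apply: le_trans h1; rewrite ler_norm.
  have h4 : #|G|%:R / N <= expR (th - D).
    have -> : #|G|%:R / N = \sum_(y in G) N^-1 by rewrite sumr_const -[RHS]mulr_natl.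
    apply: (@le_trans _ _ (\sum_(y in G) expR (th - D) * heat t y)).
      apply: ler_sum => y /hG /andP[hy _].
      rewrite -(opprB D th) expRN ler_pdivlMl ?expR_gt0// mulrC.
      by rewrite ler_pdivrMl.
    rewrite -mulr_sumr -[leRHS]mulr1 ler_wpM2l ?expR_ge0// -h2 lerDl.
    exact: sumr_ge0.
  lra.
(* On G the density is at most exp(D + th), and [hD] removes D. The logarithm of 8 / e^3 in [hu] is
   that of 2 / e divided by (e / 2)^2. *)
apply: (@smoothing t u e (2 / e * expR (2 * th)) G) => //; rewrite ?(ltW t0) ?(ltW e0)//.
- by rewrite mulr_ge0 ?expR_ge0// divr_ge0// ltW.
- move=> x /hG /andP[_ hx]; apply: le_trans hx _.
  have -> : D + th = - (th - D) + 2 * th by ring.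
  rewrite expRD ler_wpM2r ?expR_ge0// expRN -[2 / e]invf_div lef_pV2 ?posrE ?expR_gt0//.
  by rewrite divr_gt0.
have e30 : 0 < 8 / e ^+ 3 by rewrite divr_gt0// exprn_gt0.
rewrite -ler_expR expRD lnK ?posrE// in hu.
rewrite expRN ler_pdivrMl ?expR_gt0//.
have -> : 2 / e * expR (2 * th) = expR (2 * th) * (8 / e ^+ 3) * (e / 2) ^+ 2.
  by field; rewrite gt_eqF.
by rewrite ler_wpM2r ?sqr_ge0.
Qed.

End WithGap.
End MixingBounds.

(** * From the spectral gap to the ratio of mixing times *)

Section CutoffRatio.
Variables (R : realType) (X : finZmodType) (S : {set X}).
Local Notation A := (group_algebra R X).
Hypothesis S0 : (0 < #|S|)%N.
Hypothesis symS : forall s, s \in S -> - s \in S.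
Local Notation kap := (step_law R S).
Local Notation N := (#|X|%:R : R).
Variable c : R.
Hypotheses (c0 : 0 < c)
  (gap : forall f : A, mass f = 0 -> c * dot f f <= dot f f - dot (kap * f) f).

Let N0 : 0 < N.
Proof. by rewrite ltr0n; apply/card_gt0P; exists 0. Qed.

(** The centred indicator of the generated subgroup is invariant under the walk, so a positive gap
    forces it to vanish. *)
Lemma gap_generates : generates S.
Proof.
rewrite /generates; set H := <<S>>%G.
pose b : R := #|H|%:R / N.
pose f : A := [ffun x => (x \in H)%:R - b].
have f0 : mass f = 0.
  rewrite /mass; under eq_bigr do rewrite ffunE.
  rewrite sumrB -natr_sum -big_mkcond /= sum1_card sumr_const -[b *+ _]mulr_natl.
  by rewrite /b mulrCA divff ?gt_eqF// mulr1 subrr.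
have kf : kap * f = f.
  apply/ffunP => x; rewrite convE -[RHS]mul1r -(mass_step_law R S0) /mass mulr_suml.
  apply: eq_bigr => y _; have [yS|yS] := boolP (y \in S); last first.
    by rewrite [kap y]ffunE (negbTE yS) mulr0 !mul0r.
  rewrite ![f _]ffunE; congr (_ * ((nat_of_bool _)%:R - _)).
  have yH : y \in H by apply: mem_gen.
  by rewrite -[x - y]/(x * y^-1)%g groupMr// groupV.
have := gap f0; rewrite kf subrr pmulr_rle0// => ff.
have fz : f = 0 by apply: dot_eq0; apply/eqP; rewrite eq_le ff dot_ge0.
apply/eqP/setP => x; rewrite inE; apply/negPn/negP => xH.
have := congr1 (fun h : A => h x) fz.
rewrite [f x]ffunE zero_alg_coef (negbTE xH) sub0r => /eqP.
rewrite oppr_eq0 /b mulf_eq0 invr_eq0 (gt_eqF N0) orbF pnatr_eq0 -leqn0 leqNgt.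
by rewrite cardG_gt0.
Qed.

(** The window grows like the square root of t, hence falls below [eta * t] once t passes a
    threshold. After squaring, with (2 q + w)^2 <= 8 q^2 + 2 w^2, this threshold appears as a
    condition on [rho]. *)
Lemma mixing_window_linear (e eta rho t : R) : 0 < e -> e < 1 -> 0 < eta ->
  1 <= rho -> rho <= t ->
  16 * (20 + 2 * ln #|S|%:R ^+ 2) / e + 128 / e ^+ 6 <= 4 * eta ^+ 2 * c ^+ 2 * rho ->
  2 * Num.sqrt (2 * t * (20 + 2 * ln #|S|%:R ^+ 2) / e) + ln (8 / e ^+ 3) <=
  2 * (eta * t) * c.
Proof.
move=> e0 e1 eta0 rho1 rt; set W := 20 + _ => h.
have t1 : 1 <= t by apply: le_trans rt.
have t0 : 0 < t by apply: lt_le_trans t1.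
have W0 : 0 < W by rewrite /W; have := sqr_ge0 (ln (#|S|%:R : R)); lra.
have e3 : 0 < 8 / e ^+ 3 by rewrite divr_gt0// exprn_gt0.
have hl : ln (8 / e ^+ 3) <= 8 / e ^+ 3 by rewrite ltW// ln_sublinear.
apply: le_trans (lerD (lexx _) hl) _.
rewrite -(ler_pXn2r (ltn0Sn 1)) ?nnegrE ?addr_ge0 ?mulr_ge0 ?sqrtr_ge0 ?invr_ge0 ?exprn_ge0 ?(ltW e0) ?(ltW eta0) ?(ltW t0) ?(ltW c0)//.
set q := Num.sqrt _; set w := 8 / e ^+ 3.
have hq : q ^+ 2 = 2 * t * W / e by rewrite sqr_sqrtr// ltW// divr_gt0// !mulr_gt0.
have hw : w ^+ 2 = 64 / e ^+ 6 by rewrite /w; field; rewrite gt_eqF.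
have h1 : (2 * q + w) ^+ 2 <= 8 * q ^+ 2 + 2 * w ^+ 2.
  by have := sqr_ge0 (2 * q - w); rewrite sqrrB sqrrD; lra.
apply: (le_trans h1); rewrite hq hw.
have e6 : 0 < 128 / e ^+ 6 by rewrite divr_gt0// exprn_gt0.
have h2 : 8 * (2 * t * W / e) + 2 * (64 / e ^+ 6) <= t * (16 * W / e + 128 / e ^+ 6).
  have : 128 / e ^+ 6 <= t * (128 / e ^+ 6) by rewrite ler_peMl// ltW.
  have -> : t * (16 * W / e + 128 / e ^+ 6) = 8 * (2 * t * W / e) + t * (128 / e ^+ 6) by ring.
  have -> : 2 * (64 / e ^+ 6) = 128 / e ^+ 6 by ring.
  lra.
apply: (le_trans h2).
apply: (@le_trans _ _ (t * (4 * eta ^+ 2 * c ^+ 2 * rho))).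
  by rewrite ler_wpM2l// ltW.
apply: (@le_trans _ _ (t * (4 * eta ^+ 2 * c ^+ 2 * t))).
  by rewrite ler_wpM2l ?(ltW t0)// ler_wpM2l// mulr_ge0 ?sqr_ge0// mulr_ge0 ?sqr_ge0.
by rewrite le_eqVlt; apply/orP; left; apply/eqP; ring.
Qed.

(** Any time t admissible for 1 - e is at least (e / 2) r by [mixing_lower], so a window of length
    [eta * t] suffices and (1 + eta) t is admissible for e. The comparison passes to infima,
    attained or not. *)
Lemma mixing_ratio (e eta : R) (r : nat) : 0 < e -> e <= 2^-1 -> 0 < eta ->
  1 <= e / 2 * r%:R -> #|S|.+1%:R ^+ r / N <= e / 2 ->
  16 * (20 + 2 * ln #|S|%:R ^+ 2) / e + 128 / e ^+ 6 <=
    4 * eta ^+ 2 * c ^+ 2 * (e / 2 * r%:R) ->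
  let m1 := mixing_time S (1 - e) in let m2 := mixing_time S e in
  [/\ 0 < m1, m1 <= m2 & m2 <= (1 + eta) * m1].
Proof.
move=> e0 e2 eta0 hr hN hK m1 m2.
have e1 : e < 1 by lra.
set rho := e / 2 * r%:R in hr hK.
have r0 : (0 < r)%N.
  by rewrite lt0n; apply/eqP => rE; move: hr; rewrite /rho rE mulr0 ler10.
pose A1 := [set t : R | 0 <= t /\ worst_tv S t <= 1 - e].
pose A2 := [set t : R | 0 <= t /\ worst_tv S t <= e].
have lbA (v : R) : has_lbound [set t : R | 0 <= t /\ worst_tv S t <= v].
  by exists 0 => t [].
have A2A1 t : A2 t -> A1 t by move=> [t0 h]; split=> //; lra.
have A2n : A2 !=set0.
  by have [t t0 h] := mixing_set_nonempty S0 gap e0 c0; exists t.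
have A1n : A1 !=set0 by have [t /A2A1 ?] := A2n; exists t.
have rhoA1 t : A1 t -> rho <= t by move=> [t0 h]; apply: mixing_lower hN h.
have m1rho : rho <= m1 by apply: lb_le_inf => // t /rhoA1.
split; first by lra.
  by apply: lb_le_inf => // t /A2A1 h; apply: ge_inf.
rewrite mulrC -ler_pdivrMr; last by lra.
apply: lb_le_inf => // t At; have rt := rhoA1 _ At; have [t0 ht] := At.
rewrite ler_pdivrMr; last by lra.
have -> : t * (1 + eta) = t + eta * t by ring.
have et0 : 0 <= eta * t by rewrite mulr_ge0// ltW.
apply: ge_inf; first exact: lbA.
split; first by rewrite addr_ge0.
apply: (mixing_window S0 symS gap) => //; first by lra.
exact: mixing_window_linear hr rt hK.
Qed.

(** For e above 1/2 the two mixing times exchange roles; the sandwich for [e'] bounds both the ratio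
    and its inverse. *)
Lemma mixing_ratio_dist (e eta : R) (r : nat) : 0 < e -> e < 1 -> 0 < eta ->
  let e' := Num.min e (1 - e) in
  1 <= e' / 2 * r%:R -> #|S|.+1%:R ^+ r / N <= e' / 2 ->
  16 * (20 + 2 * ln #|S|%:R ^+ 2) / e' + 128 / e' ^+ 6 <=
    4 * eta ^+ 2 * c ^+ 2 * (e' / 2 * r%:R) ->
  `|mixing_time S (1 - e) / mixing_time S e - 1| <= eta.
Proof.
move=> e0 e1 eta0 e' h1 h2 h3.
have e'0 : 0 < e' by rewrite lt_min e0 subr_gt0.
have e'2 : e' <= 2^-1 by rewrite /e' ge_min; apply/orP; case: (leP e 2^-1) => ?; [left|right; lra].
have /= [m10 m12 m21] := mixing_ratio e'0 e'2 eta0 h1 h2 h3.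
have m20 : 0 < mixing_time S e' := lt_le_trans m10 m12.
move: m10 m12 m21 m20; rewrite /e' minEle; have [_|_] := leP e (1 - e).
  set m1 := mixing_time S (1 - e); set m2 := mixing_time S e => m10 m12 m21 m20.
  have h12 : eta * m1 <= eta * m2 by rewrite ler_wpM2l// ltW.
  have hm1 : 0 < eta * m1 by rewrite mulr_gt0.
  by rewrite ler_distl ler_pdivlMr// ler_pdivrMr//; apply/andP; split; lra.
rewrite opprB addrCA subrr addr0.
set m1 := mixing_time S e; set m2 := mixing_time S (1 - e) => m10 m12 m21 m20.
have hm1 : 0 < eta * m1 by rewrite mulr_gt0.
by rewrite ler_distl ler_pdivlMr// ler_pdivrMr//; apply/andP; split; lra.
Qed.

End CutoffRatio.

(** * Random generators *)

Section IidProb.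
Variables (R : realType) (X : finZmodType) (d : nat).
Local Notation N := (#|X|%:R : R).
Local Notation Z := {ffun 'I_d -> X}.
Implicit Types (E F : Z -> Prop).

Let N0 : 0 < N.
Proof. by rewrite ltr0n; apply/card_gt0P; exists 0. Qed.

Lemma iid_probE E : iid_prob R E = \sum_(z : Z) (`[< E z >])%:R * N ^- d.
Proof.
rewrite /iid_prob big_mkcond; apply: eq_bigr => z _.
rewrite /uniform_law prodr_const card_ord exprVn.
by case: asboolP; rewrite ?mul1r ?mul0r.
Qed.

Lemma iid_prob_ge0 E : 0 <= iid_prob R E.
Proof. by rewrite iid_probE sumr_ge0// => z _; rewrite mulr_ge0// invr_ge0 exprn_ge0. Qed.

Lemma iid_prob_total : iid_prob R (fun _ : Z => True) = 1.
Proof.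
rewrite iid_probE -mulr_suml -natr_sum.
have -> : (\sum_(z : Z) `[< True >])%N = (#|X| ^ d)%N.
  rewrite (eq_bigr (fun=> 1%N)); last by move=> z _; rewrite asboolT.
  by rewrite sum1_card card_ffun card_ord.
by rewrite natrX divff// expf_neq0// gt_eqF.
Qed.

Lemma iid_prob_union E F G : (forall z, E z -> F z \/ G z) ->
  iid_prob R E <= iid_prob R F + iid_prob R G.
Proof.
move=> h; rewrite !iid_probE -big_split; apply: ler_sum => z _ /=.
rewrite -mulrDl ler_wpM2r ?invr_ge0 ?exprn_ge0// -natrD ler_nat.
case: asboolP => // /h [Fz|Gz]; first by rewrite (asboolT Fz).
by rewrite (asboolT Gz) addn1.
Qed.

Lemma iid_prob_mono E F : (forall z, E z -> F z) -> iid_prob R E <= iid_prob R F.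
Proof.
move=> h; rewrite !iid_probE; apply: ler_sum => z _ /=.
rewrite ler_wpM2r ?invr_ge0 ?exprn_ge0// ler_nat.
by case: asboolP => // /h Fz; rewrite (asboolT Fz).
Qed.

Lemma iid_prob_le1 E : iid_prob R E <= 1.
Proof. by rewrite -iid_prob_total; apply: iid_prob_mono. Qed.

Lemma iid_prob_markov E (f : Z -> R) (delta : R) : 0 < delta ->
  (forall z, 0 <= f z) -> (forall z, E z -> delta <= f z) ->
  iid_prob R E <= (\sum_z f z * N ^- d) / delta.
Proof.
move=> d0 f0 h; rewrite ler_pdivlMr// iid_probE mulr_suml; apply: ler_sum => z _.
rewrite mulrAC ler_wpM2r ?invr_ge0 ?exprn_ge0//.
by case: asboolP => [/h|_]; rewrite ?mul1r ?mul0r.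
Qed.

(** Union bound over ordered pairs of distinct indices, each colliding with probability 1 / N. *)
Lemma iid_prob_collision : iid_prob R (fun z : Z => ~ injective z) <= d%:R ^+ 2 / N.
Proof.
(* Writes the event that z i and z j both equal x as a product over coordinates, so that the sum
   over z factorises. *)
pose g (i j : 'I_d) (x : X) (k : 'I_d) (y : X) : R :=
  if (k == i) || (k == j) then (y == x)%:R / N else N^-1.
have hij i j : i != j -> \sum_(z : Z) (z i == z j)%:R * N ^- d = N^-1.
  move=> ij; have E1 (z : Z) : (z i == z j)%:R * N ^- d = \sum_x \prod_k g i j x k (z k).
    have E2 x : \prod_k g i j x k (z k) = ((z i == x) && (z j == x))%:R * N ^- d.
      have -> : N ^- d = \prod_(k < d) N^-1 by rewrite prodr_const card_ord exprVn.
      rewrite (bigD1 i)//= (bigD1 j) 1?eq_sym//= [in RHS](bigD1 i)//= [in RHS](bigD1 j) 1?eq_sym//=.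
      rewrite /g eqxx eqxx orbT /=.
      rewrite [in LHS](eq_bigr (fun=> N^-1)); last first.
        by move=> k /andP[/negPf -> /negPf ->].
      by case: (z i == x); case: (z j == x); rewrite /= ?mul0r ?mulr0 ?mul0r ?mulr0 ?mul1r.
    under eq_bigr do rewrite E2.
    rewrite -mulr_suml; congr (_ * _); rewrite (bigD1 (z i))//= eqxx /= big1 ?addr0 1?eq_sym//.
    by move=> x /negPf xi; rewrite eq_sym xi.
  under eq_bigr do rewrite E1.
  rewrite exchange_big /=.
  have E3 x : \sum_(z : Z) \prod_k g i j x k (z k) = N^-1 * N^-1.
    rewrite -(bigA_distr_bigA (fun k y => g i j x k y)) /=.
    rewrite (bigD1 i)//= (bigD1 j) 1?eq_sym//= [X in _ * (_ * X)]big1 ?mulr1.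
      have E4 : \sum_y (y == x)%:R / N = N^-1.
        by rewrite -mulr_suml (bigD1 x)//= eqxx big1 ?addr0 ?mul1r// => y /negPf ->.
      by congr (_ * _); rewrite -[RHS]E4; apply: eq_bigr => y _; rewrite /g eqxx ?orbT.
    move=> k /andP[/negPf ki /negPf kj].
    under eq_bigr do rewrite /g ki kj /=.
    by rewrite sumr_const -[_ *+ _]mulr_natl divff// gt_eqF.
  under eq_bigr do rewrite E3.
  by rewrite sumr_const -[_ *+ _]mulr_natl mulrA divff ?mul1r// gt_eqF.
apply: (@le_trans _ _ (\sum_(i < d) \sum_(j < d) N^-1)); last first.
  rewrite !sumr_const card_ord -mulrnA -[_ *+ _]mulr_natl natrM expr2.
  by rewrite lexx.
apply: (@le_trans _ _ (\sum_(i < d) \sum_(j < d | i != j) N^-1)); last first.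
  apply: ler_sum => i _; rewrite big_mkcond; apply: ler_sum => j _.
  by case: ifP => // _; rewrite invr_ge0 ltW.
have -> : \sum_(i < d) \sum_(j < d | i != j) N^-1 =
   \sum_(z : Z) (\sum_(i < d) \sum_(j < d | i != j) (z i == z j)%:R) * N ^- d.
  under [RHS]eq_bigr do rewrite mulr_suml.
  rewrite [RHS]exchange_big; apply: eq_bigr => i _ /=.
  under [RHS]eq_bigr do rewrite mulr_suml.
  by rewrite [RHS]exchange_big; apply: eq_bigr => j ij; rewrite hij.
rewrite iid_probE; apply: ler_sum => z _.
rewrite ler_wpM2r ?invr_ge0 ?exprn_ge0//; case: asboolP => ninj; last by rewrite sumr_ge0// => k _; rewrite sumr_ge0.
have [i [j [ij zij]]] : exists i j, i != j /\ z i = z j.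
  apply: contrapT => h; apply: ninj => i j zij; apply/eqP/negPn/negP => ij.
  by apply: h; exists i, j.
rewrite (bigD1 i)//= (bigD1 j)//= zij eqxx -addrA lerDl addr_ge0//.
  by rewrite sumr_ge0.
by rewrite sumr_ge0// => k _; rewrite sumr_ge0.
Qed.

End IidProb.

(** * Spectral gap of a random sample *)

Section RandomGap.
Variables (R : realType) (X : finZmodType).
Local Notation A := (group_algebra R X).
Local Notation N := (#|X|%:R : R).

Let N0 : 0 < N.
Proof. by rewrite ltr0n; apply/card_gt0P; exists 0. Qed.

(* The collision probability of two random subset sums of [z_1, ..., z_d]; the
   uniform average of [coin * star coin] is [1 - b v] with [v] idempotent. *)
Lemma mean_collision (d : nat) (p : R) :
  \sum_(z : {ffun 'I_d -> X})
    dot (\prod_i coin p (z i)) (\prod_i coin p (z i)) * N ^- d =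
  N^-1 + (1 - 2 * p * (1 - p)) ^+ d * (1 - N^-1).
Proof.
set b := 2 * p * (1 - p).
pose u : A := [ffun=> N^-1].
have uf (f : A) : u * f = mass f *: u.
  apply/ffunP => x; rewrite mulrC convE scale_alg_coef [u x]ffunE /mass mulr_suml.
  by apply: eq_bigr => y _; rewrite [u _]ffunE.
have mu : mass u = 1.
  by rewrite /mass; under eq_bigr do rewrite ffunE; rewrite sumr_const -[_ *+ _]mulr_natl divff ?gt_eqF.
have dsum : N^-1 *: \sum_x dirac_alg R x = u.
  apply/ffunP => y; rewrite !algE [u y]ffunE.
  rewrite (bigD1 y)//= ffunE eqxx big1 ?addr0 ?mulr1// => x /negPf xy.
  by rewrite ffunE eq_sym xy.
have dsumN : N^-1 *: \sum_x star (dirac_alg R x) = u.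
  rewrite -dsum; congr (_ *: _); rewrite [RHS](reindex_inj (@oppr_inj X)).
  by apply: eq_bigr => x _; rewrite star_dirac.
have NK (f : A) : N^-1 *: (f *+ #|X|) = f.
  by rewrite -(@scaler_nat R A) scalerA mulVf ?scale1r// gt_eqF.
have avgl : N^-1 *: \sum_x lapl R x = 2^-1 *: (1 - u).
  under eq_bigr do rewrite laplE.
  rewrite -scaler_sumr scalerA mulrC -scalerA !sumrB !scalerBr dsum dsumN.
  rewrite sumr_const NK.
  have -> : 2^-1 *: 1 - 2^-1 *: u = 2^-1 *: (1 - u) :> A by rewrite scalerBr.
  have -> : 2^-1 = 4^-1 * 2%:R :> R by field.
  rewrite -scalerA scaler_nat -!scalerBr; congr (_ *: _); ring.
have avg : N^-1 *: \sum_(x : X) (coin p x * star (coin p x)) = 1 - b *: (1 - u).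
  under eq_bigr do rewrite coin_star.
  rewrite sumrB -scaler_sumr scalerBr sumr_const NK.
  rewrite scalerA mulrC -scalerA avgl scalerA.
  by congr (_ - _ *: _); rewrite /b; field.
have uu : u * u = u by rewrite uf mu scale1r.
have powE (c : R) k : (1 - c *: (1 - u)) ^+ k = u + (1 - c) ^+ k *: (1 - u).
  elim: k => [|k IH]; first by rewrite !expr0 scale1r addrC subrK.
  rewrite !exprS IH !cstE cstM cstB cst1.
  set w := cst X c; set B := cst X (_ ^+ _).
  have -> : (1 - w * (1 - u)) * (u + B * (1 - u)) =
    u + (1 - w) * B * (1 - u) - (w - w * B) * (u - u * u) by ring.
  by rewrite uu subrr mulr0 subr0.
have -> : \sum_(z : {ffun 'I_d -> X})
    dot (\prod_i coin p (z i)) (\prod_i coin p (z i)) * N ^- d =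
    ((N^-1 *: \sum_(x : X) (coin p x * star (coin p x))) ^+ d) 0.
  rewrite exprZn.
  have -> : (\sum_(x : X) (coin p x * star (coin p x))) ^+ d =
      \prod_(i < d) \sum_(x : X) (coin p x * star (coin p x)).
    by rewrite prodr_const card_ord.
  rewrite bigA_distr_bigA /=.
  rewrite scale_alg_coef sum_alg_coef mulr_sumr exprVn; apply: eq_bigr => z _.
  by rewrite /dot star_prod -big_split mulrC.
rewrite avg powE algE scale_alg_coef sub_alg_coef one_alg_coef eqxx.
by rewrite [u 0]ffunE.
Qed.

(** Makes the excess collision probability nonnegative, as Markov's inequality demands. *)
Lemma dot_ge_mass (f : A) : mass f = 1 -> N^-1 <= dot f f.
Proof.
move=> f1; pose one : A := [ffun=> 1].
have fo : dot f one = 1.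
  by rewrite dotE -[RHS]f1; apply: eq_bigr => x _; rewrite [one x]ffunE mulr1.
have oo : dot one one = N.
  by rewrite dotE; under eq_bigr do rewrite !ffunE mulr1; rewrite sumr_const.
have := dot_CS f one; rewrite fo oo expr1n => h.
by rewrite -[N^-1]mul1r ler_pdivrMr.
Qed.

Lemma sym_setN (d : nat) (z : {ffun 'I_d -> X}) s : s \in sym_set z -> - s \in sym_set z.
Proof.
rewrite !inE => /orP[|] /imsetP[i _ ->]; apply/orP; [right|left].
  by apply/imsetP; exists i.
by apply/imsetP; exists i; rewrite ?opprK.
Qed.

Lemma card_sym_set (d : nat) (z : {ffun 'I_d -> X}) : (#|sym_set z| <= d.*2)%N.
Proof.
rewrite (leq_trans (leq_card_setU _ _))// -addnn leq_add//.
  by rewrite (leq_trans (leq_imset_card _ _))// card_ord.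
by rewrite (leq_trans (leq_imset_card _ _))// card_ord.
Qed.

Lemma sym_set_gt0 (d : nat) (z : {ffun 'I_d -> X}) : (0 < d)%N -> (0 < #|sym_set z|)%N.
Proof.
move=> d0; apply/card_gt0P; exists (z (Ordinal d0)); rewrite inE; apply/orP; left.
by apply/imsetP; exists (Ordinal d0).
Qed.

Lemma step_law_dirichlet (S : {set X}) (f : A) : (0 < #|S|)%N ->
  dot f f - dot (step_law R S * f) f =
  2 / #|S|%:R * \sum_(s in S) dot (lapl R s * f) f.
Proof.
move=> S0; have cS : #|S|%:R != 0 :> R by rewrite pnatr_eq0 -lt0n.
have -> : step_law R S * f = #|S|%:R^-1 *: \sum_(s in S) dirac_alg R s * f.
  apply/ffunP => x; rewrite convE !algE [in RHS]big_mkcond mulr_sumr; apply: eq_bigr => s _.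
  rewrite [step_law _ _ _]ffunE; case: ifP => _; last by rewrite !mulr0 mul0r.
  by rewrite dirac_algM mulr1.
under [X in _ = _ * X]eq_bigr do rewrite dot_lapl.
rewrite -mulr_sumr sumrB sumr_const dotZl.
have -> : dot (\sum_(s in S) dirac_alg R s * f) f = \sum_(s in S) dot (dirac_alg R s * f) f.
  elim/big_rec2: _ => [|i x y _ <-]; last by rewrite dotDl.
  by rewrite dotE big1// => x _; rewrite algE mul0r.
by rewrite -[dot f f *+ _]mulr_natl; field.
Qed.

(** Injectivity turns the sum over indices into a sum over distinct elements of S. The factor 2 of
    the Dirichlet form compensates |S| <= 2 d, the inverses being dropped from the sum. *)
Lemma gap_of_sample (d : nat) (z : {ffun 'I_d -> X}) (c : R) (f : A) :
  (0 < d)%N -> injective z ->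
  d%:R * c * dot f f <= \sum_i dot (lapl R (z i) * f) f -> 0 <= c ->
  c * dot f f <= dot f f - dot (step_law R (sym_set z) * f) f.
Proof.
move=> d0 zi h c0; set S := sym_set z.
have S0 : (0 < #|S|)%N by exact: sym_set_gt0.
have cS : 0 < #|S|%:R :> R by rewrite ltr0n.
rewrite step_law_dirichlet//.
have h1 : \sum_i dot (lapl R (z i) * f) f <= \sum_(s in S) dot (lapl R s * f) f.
  rewrite (big_setID [set z i | i : 'I_d]%SET) /=.
  have -> : (S :&: [set z i | i : 'I_d])%SET = [set z i | i : 'I_d]%SET.
    by apply/finset.setIidPr; exact: finset.subsetUl.
  rewrite big_imset /=; last by move=> i j _ _; exact: zi.
  by rewrite lerDl sumr_ge0// => s _; exact: (pos_psd (@pos_lapl R X s)).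
rewrite mulrAC ler_pdivlMr//.
apply: (@le_trans _ _ (2 * (d%:R * c * dot f f))); last first.
  by rewrite ler_wpM2l// (le_trans h).
rewrite [leRHS](_ : _ = c * dot f f * (d.*2)%:R); last by rewrite -mul2n natrM; ring.
by rewrite ler_wpM2l ?mulr_ge0 ?dot_ge0// ler_nat card_sym_set.
Qed.

End RandomGap.

Lemma double_succ_le_cube (d : nat) : (2 <= d)%N -> (d.*2.+1 <= d ^ 3)%N.
Proof.
move=> d2; apply: (@leq_trans (4 * d)%N).
  by rewrite -mul2n; lia.
by rewrite expnS mulnC leq_mul// -[4%N]/(2 ^ 2)%N leq_exp2r.
Qed.

Definition has_gap (R : realType) (X : finZmodType) (c : R) (S : {set X}) :=
  forall f : group_algebra R X, mass f = 0 ->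
    c * dot f f <= dot f f - dot (step_law R S * f) f.

(** The decay rate and the gap depend on [a] alone, which makes the estimate uniform along the
    sequence of groups. *)
Lemma random_gap (R : realType) (a : R) : 1 < a ->
  exists sc : R * R, [/\ 0 < sc.1 < 1, 0 < sc.2 &
    forall (X : finZmodType) (d : nat), (0 < d)%N ->
    a * (ln #|X|%:R / ln 2) <= d%:R ->
    iid_prob R (fun z : {ffun 'I_d -> X} => ~ has_gap sc.2 (sym_set z))
      <= sc.1 ^+ d + d%:R ^+ 2 / #|X|%:R].
Proof.
move=> a1; have a0 : 0 < a by apply: lt_trans a1.
have l2 : 0 < ln 2 :> R by rewrite ln_gt0// ltr1n.
(* This is 2^(-1/a), so the hypothesis on d reads N th^d <= 1. It exceeds 1/2 since a > 1, and [p]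
   is tuned so that 1 - 2 p (1 - p) is the midpoint [B] of 1/2 and [th]. *)
pose th : R := expR (- (ln 2 / a)).
have th0 : 0 < th by exact: expR_gt0.
have th1 : th < 1 by rewrite expR_lt1 oppr_lt0 divr_gt0.
have th2 : 2^-1 < th.
  have -> : 2^-1 = expR (- ln 2) :> R by rewrite expRN lnK// posrE.
  by rewrite ltr_expR ltrN2 ltr_pdivrMr// ltr_pMr.
pose q : R := (th - 2^-1) / 4; have q0 : 0 < q by rewrite divr_gt0// subr_gt0.
have q8 : q < 4^-1 by rewrite /q; lra.
pose eta := Num.sqrt q.
have eq : eta ^+ 2 = q by rewrite sqr_sqrtr// ltW.
have eta0 : 0 <= eta by exact: sqrtr_ge0.
have eta2 : eta <= 2^-1.
  by rewrite -(ler_pXn2r (ltn0Sn 1)) ?nnegrE// eq; lra.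
pose p := 2^-1 - eta.
have p01 : 0 <= p <= 1 by rewrite /p; apply/andP; split; lra.
pose B : R := (th + 2^-1) / 2.
have pB : 1 - 2 * p * (1 - p) = B.
  have -> : 1 - 2 * p * (1 - p) = 2^-1 + 2 * eta ^+ 2 by rewrite /p; field.
  by rewrite eq /q /B; field.
have p4 : 1 - 4 * p * (1 - p) = 4 * q.
  by rewrite -eq /p; field.
have B0 : 0 < B by rewrite /B; lra.
pose kp := B / th.
have kp0 : 0 < kp by rewrite divr_gt0.
have kp1 : kp < 1 by rewrite ltr_pdivrMr// mul1r /B; lra.
(* The mean excess is at most kp^d = sg^(2 d); Markov's inequality at level sg^d fails with
   probability at most sg^d. *)
pose sg := Num.sqrt kp.
have sg0 : 0 < sg by rewrite sqrtr_gt0.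
have sg2 : sg ^+ 2 = kp by rewrite sqr_sqrtr// ltW.
have sg1 : sg < 1 by rewrite -sqrtr1 ltr_sqrt.
(* Since (1 - 2^-l)^(2^(l+j)) <= exp(-2^j), a value of j independent of d meets the endpoint
   condition of [gap_of_coins]. *)
pose j := Num.bound (- ln (4 * q)).
have q40 : 0 < 4 * q by rewrite pmulr_rgt0.
have hj : expR (- (2 ^ j)%:R) <= 4 * q.
  rewrite -[leRHS](@lnK R) ?posrE//.
  rewrite ler_expR lerNl.
  apply: (@le_trans _ _ j%:R); last by rewrite ler_nat ltnW// ltn_expl.
  apply: le_trans (ler_norm _) _.
  by have /andP[_ /ltW] := truncn_itv (normr_ge0 (- ln (4 * q))).
(* Chosen so that rho^(2^(l+j)) = sg^(2^(l-1)), which is at least sg^d because 2^(l-1) <= d. *)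
pose rho := expR (ln sg / (2 ^ j.+1)%:R).
have e2j : (2 ^ j.+1)%:R != 0 :> R by rewrite pnatr_eq0 -lt0n expn_gt0.
have rho0 : 0 < rho by exact: expR_gt0.
have rhoX : rho ^+ (2 ^ j.+1) = sg.
  by rewrite -expRM_natr divfK// lnK.
have rho1 : rho < 1.
  rewrite expR_lt1 pmulr_llt0 ?invr_gt0 ?ltr0n ?expn_gt0//.
  by rewrite ln_lt0// sg0 sg1.
exists (sg, 1 - rho); split=> /=; [by rewrite sg0 sg1|by rewrite subr_gt0|].
move=> X d d0 hd; set N : R := #|X|%:R in hd *.
have N0 : 0 < N by rewrite ltr0n; apply/card_gt0P; exists 0.
pose T (z : {ffun 'I_d -> X}) : group_algebra R X := \prod_i coin p (z i).
pose F z := N * dot (T z) (T z) - 1.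
have F0 z : 0 <= F z.
  rewrite /F subr_ge0 -ler_pdivrMl// mulr1 dot_ge_mass//.
  exact: mass_prod_coin.
have hF : \sum_z F z * N ^- d <= kp ^+ d.
  have -> : \sum_z F z * N ^- d = N * (N^-1 + B ^+ d * (1 - N^-1)) - 1.
    have := @mean_collision R X d p; rewrite pB -/N => <-.
    rewrite mulr_sumr.
    have -> : 1 = \sum_(z : {ffun 'I_d -> X}) N ^- d.
      rewrite sumr_const card_ffun card_ord -[_ *+ _]mulr_natl natrX divff//.
      by rewrite expf_neq0// gt_eqF.
    by rewrite -sumrB; apply: eq_bigr => z _; rewrite /F /T -/N; ring.
  have -> : N * (N^-1 + B ^+ d * (1 - N^-1)) - 1 = N * B ^+ d - B ^+ d.
    by field; rewrite gt_eqF.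
  have Nth : N * th ^+ d <= 1.
    rewrite /th -expRM_natr -[N in leLHS](@lnK R) ?posrE// -expRD expR_le1.
    move: hd; rewrite mulrA ler_pdivrMr// => hd.
    rewrite mulNr subr_le0 mulrAC ler_pdivlMr// mulrC (le_trans hd)//.
    by rewrite mulrC.
  have BE : B ^+ d = th ^+ d * kp ^+ d by rewrite -exprMn /kp mulrCA divff ?mulr1// gt_eqF.
  apply: (@le_trans _ _ (N * B ^+ d)).
    by rewrite gerBl exprn_ge0// ltW.
  by rewrite BE mulrA -[leRHS]mul1r ler_wpM2r// exprn_ge0// ltW.
pose l := (trunc_log 2 d).+1.
have /andP[dl1 dl2] : (2 ^ l.-1 <= d < 2 ^ l)%N by exact: trunc_log_bounds.
apply: le_trans (@iid_prob_union R X d _ (fun z => sg ^+ d <= F z) (fun z => ~ injective z) _) _; last first.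
  apply: lerD; last exact: iid_prob_collision.
  apply: (le_trans (@iid_prob_markov R X d _ F (sg ^+ d) _ F0 (fun z h => h))).
    by rewrite exprn_gt0.
  rewrite ler_pdivrMr ?exprn_gt0//; apply: (le_trans hF).
  by rewrite -sg2 -exprM mul2n -addnn exprD.
move=> z ngap; apply: contrapT => /not_orP[/negP hFz /contrapT zi].
rewrite -ltNge in hFz; apply: ngap => f f0.
apply: gap_of_sample => //; last by rewrite subr_ge0 ltW.
apply: (@gap_of_coins _ _ _ _ p (sg ^+ d) rho l j) => //.
- exact: ltnW.
- exact: ltW.
- rewrite p4; apply: le_trans hj.
  have l0 : 0 < (2 ^ l)%:R :> R by rewrite ltr0n expn_gt0.
  have -> : expR (- (2 ^ j)%:R) = expR (- (2 ^ l)%:R^-1) ^+ (2 ^ (l + j)) :> R.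
    by rewrite -expRM_natr expnD natrM mulNr mulKf// gt_eqF.
  rewrite lerXn2r ?nnegrE ?expR_ge0 ?expR_ge1Dx//.
  by rewrite subr_ge0 invf_le1// ler1n expn_gt0.
- exact: ltW.
- have -> : (2 ^ (l + j) = 2 ^ j.+1 * 2 ^ l.-1)%N by rewrite -expnD addSnnS addnC.
  by rewrite exprM rhoX ler_wiXn2l// ltW.
Qed.

(** * Asymptotics under the growth hypotheses *)

Section Asymptotics.
Variables (R : realType) (a : R) (ha : 1 < a).
Variables (X : nat -> finZmodType) (d : nat -> nat).
Hypotheses (hX : forall n, (3 <= #|X n|)%N) (hd0 : forall n, (0 < d n)%N)
  (hd : forall n, a * (ln #|X n|%:R / ln 2) <= (d n)%:R)
  (hlog : ln (d n)%:R / (ln #|X n|%:R `^ 3^-1) @[n --> \oo] --> (0 : R)).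

Local Notation N n := (#|X n|%:R : R).
Local Notation L n := (ln (N n)).
Local Notation ell n := (ln ((d n)%:R : R)).

Let l2 : 0 < ln 2 :> R. Proof. by rewrite ln_gt0// ltr1n. Qed.
Let l2le : ln 2 <= 1 :> R.
Proof. by have := @le_ln1Dx R 1; rewrite -[1 + 1]/(2 : R); apply; lra. Qed.

Let N0 n : 0 < N n. Proof. by rewrite ltr0n (leq_trans _ (hX n)). Qed.

Let L0 n : 0 < L n.
Proof. by rewrite ln_gt0// ltr1n (leq_trans _ (hX n)). Qed.

Let dL n : L n <= (d n)%:R.
Proof.
apply: le_trans (hd n); rewrite mulrA ler_pdivlMr//.
apply: (@le_trans _ _ (L n * 1)); first by rewrite ler_wpM2l ?(ltW (L0 n)).
by rewrite mulr1 ler_peMl ?(ltW (L0 n))// ltW.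
Qed.

Let d2 n : (2 <= d n)%N.
Proof.
rewrite -(ltr_nat R); apply: lt_le_trans (hd n).
rewrite mulrA ltr_pdivlMr// mul1r.
apply: (@lt_le_trans _ _ (L n)).
  by rewrite ltr_ln ?posrE// ltr_nat (leq_trans _ (hX n)).
by rewrite ler_peMl ?(ltW (L0 n))// ltW.
Qed.

Let ell2 n : ln 2 <= ell n.
Proof. by rewrite ler_ln ?posrE ?ltr0n ?hd0// ler_nat. Qed.

Let ell0 n : 0 < ell n. Proof. exact: lt_le_trans (ell2 n). Qed.

Lemma cube_small (K : R) : \forall n \near \oo, K * ell n ^+ 3 <= L n.
Proof.
pose i : R := (1 + `|K|)^-1.
have K1 : 0 < 1 + `|K| by rewrite ltr_pwDl.
have i0 : 0 < i by rewrite invr_gt0.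
have i1 : i <= 1 by rewrite invf_le1// lerDl.
have := hlog; move=> /cvgr_lt/(_ i i0); apply: filterS => n.
have Lp : 0 < L n `^ 3^-1 by rewrite powR_gt0.
rewrite ltr_pdivrMr// => h.
have L3 : (L n `^ 3^-1) ^+ 3 = L n.
  by rewrite -powR_mulrn ?ltW// -powRrM mulVf ?powRr1 ?(ltW (L0 n)).
have : ell n ^+ 3 <= (i * L n `^ 3^-1) ^+ 3.
  by rewrite lerXn2r ?nnegrE ?(ltW h) ?(ltW (ell0 n)) ?mulr_ge0 ?(ltW i0) ?(ltW Lp).
rewrite exprMn L3 => h3.
have i3 : i ^+ 3 <= i by rewrite exprS ler_piMr ?(ltW i0)// exprn_ile1// ltW.
apply: (@le_trans _ _ (`|K| * ell n ^+ 3)).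
  by rewrite ler_wpM2r ?ler_norm// exprn_ge0// ltW.
apply: (@le_trans _ _ (`|K| * (i * L n))).
  rewrite ler_wpM2l//; apply: (le_trans h3); by rewrite ler_wpM2r// ltW.
rewrite mulrA ler_piMl ?(ltW (L0 n))// /i ler_pdivrMr// mul1r lerDr//.
Qed.

(** Growth of the groups is a consequence of the hypotheses: d n >= 2 keeps ln (d n) away from 0, so
    the vanishing ratio forces ln N to infinity. *)
Lemma log_size_large (M : R) : \forall n \near \oo, M <= L n.
Proof.
have := cube_small (`|M| / ln 2 ^+ 3); apply: filterS => n; apply: le_trans.
apply: le_trans (ler_norm _) _; rewrite mulrAC ler_pdivlMr ?exprn_gt0//.
by rewrite ler_wpM2l// lerXn2r ?nnegrE ?(ltW l2) ?(ltW (ell0 n)).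
Qed.

Lemma exp_small (eps : R) : 0 < eps ->
  \forall n \near \oo, expR (- (L n / 2)) <= eps.
Proof.
move=> e0; have := log_size_large (- 2 * ln eps); apply: filterS => n h.
by rewrite -[leRHS](@lnK R) ?posrE// ler_expR; lra.
Qed.

(** The first term vanishes because d n >= ln N, the second because eventually 4 ln d <= ln N, that
    is d^2 / N <= N^(-1/2). *)
Lemma bad_event_small (s : R) : 0 < s < 1 ->
  s ^+ d n + (d n)%:R ^+ 2 / N n @[n --> \oo] --> (0 : R).
Proof.
move=> /andP[s0 s1]; apply/cvgrPdist_le => eps e0.
have ls : ln s < 0 by rewrite ln_lt0// s0 s1.
have e20 : 0 < eps / 2 by rewrite divr_gt0.
near=> n.
have h1 : s ^+ d n <= eps / 2.
  have : ln (eps / 2) / ln s <= L n by near: n; exact: log_size_large.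
  move=> h; rewrite -(lnK (_ : s \in Num.pos)) ?posrE//.
  rewrite -expRM_natr -[leRHS](@lnK R) ?posrE// ler_expR.
  by rewrite [_ * (d n)%:R]mulrC -ler_ndivrMr// (le_trans h).
have h2 : (d n)%:R ^+ 2 / N n <= eps / 2.
  apply: (@le_trans _ _ (expR (- (L n / 2)))); last by near: n; exact: exp_small.
  have : 4 / ln 2 ^+ 2 * ell n ^+ 3 <= L n by near: n; exact: cube_small.
  have h : 4 * ell n <= 4 / ln 2 ^+ 2 * ell n ^+ 3.
    have -> : 4 / ln 2 ^+ 2 * ell n ^+ 3 = 4 * ell n * (ell n ^+ 2 / ln 2 ^+ 2) by ring.
    rewrite ler_peMr ?mulr_ge0 ?(ltW (ell0 n))// ler_pdivlMr ?exprn_gt0// mul1r.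
    by rewrite lerXn2r ?nnegrE ?(ltW l2) ?(ltW (ell0 n)).
  move=> h'; have dp : 0 < (d n)%:R :> R by rewrite ltr0n.
  have -> : (d n)%:R ^+ 2 = expR (ell n * 2%:R) by rewrite expRM_natr lnK.
  rewrite -[X in _ / X](@lnK R) ?posrE// -expRN -expRD ler_expR; lra.
rewrite sub0r normrN ger0_norm; first by lra.
by rewrite addr_ge0 ?exprn_ge0 ?divr_ge0 ?(ltW s0) ?exprn_ge0.
Unshelve. all: by end_near. Qed.

(** The radius must be of order (ln d)^2 for the window to be negligible, while a ball of radius r
    has at most exp(3 r ln d) points. Both fit together exactly when (ln d)^3 is small compared with
    ln N. *)
Lemma ratio_close_of_gap (c e delta : R) : 0 < c -> 0 < e -> e < 1 -> 0 < delta ->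
  \forall n \near \oo, forall z : {ffun 'I_(d n) -> X n},
    has_gap c (sym_set z) ->
    `|mixing_time (sym_set z) (1 - e) / mixing_time (sym_set z) e - 1| <= delta.
Proof.
move=> c0 e0 e1 delta0; set e' := Num.min e (1 - e).
have e'0 : 0 < e' by rewrite lt_min e0 subr_gt0.
(* Since ln d >= ln 2, additive constants are absorbed into multiples of (ln d)^2. In [C2], the part
   C1 / D serves the window and the other part the condition that the lower bound on t is at least
   1. *)
pose C1 : R := 16 * (20 / ln 2 ^+ 2 + 8) / e' + 128 / e' ^+ 6 / ln 2 ^+ 2.
pose D : R := 4 * delta ^+ 2 * c ^+ 2 * (e' / 2).
have D0 : 0 < D by rewrite /D !mulr_gt0 ?exprn_gt0// divr_gt0.
have C10 : 0 < C1.
  by rewrite addr_gt0 ?divr_gt0 ?mulr_gt0 ?addr_gt0 ?divr_gt0 ?exprn_gt0.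
pose C2 : R := C1 / D + 2 / e' / ln 2 ^+ 2.
have C20 : 0 < C2 by rewrite addr_gt0 ?divr_gt0 ?exprn_gt0.
near=> n => z hgap.
have l20 : 0 < ln 2 ^+ 2 :> R by rewrite exprn_gt0.
have hl2 : ln 2 ^+ 2 <= ell n ^+ 2.
  by rewrite lerXn2r ?nnegrE ?(ltW l2) ?(ltW (ell0 n)).
have one_le : 1 <= ell n ^+ 2 / ln 2 ^+ 2 by rewrite ler_pdivlMr ?mul1r.
have C2l : 0 <= C2 * ell n ^+ 2 by rewrite mulr_ge0 ?(ltW C20) ?sqr_ge0.
pose r := (Num.truncn (C2 * ell n ^+ 2)).+1.
have /andP[r1 r2] : C2 * ell n ^+ 2 <= r%:R <= C2 * ell n ^+ 2 + 1.
  have /andP[t1 t2] := truncn_itv C2l.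
  by rewrite (ltW t2)/= -natr1 lerD2r.
have cS := card_sym_set z; have S0 := sym_set_gt0 z (hd0 n).
have dp : 0 < (d n)%:R :> R by rewrite ltr0n.
have d2n := d2 n.
have S1 : #|sym_set z|.+1%:R <= expR (ell n * 3%:R) :> R.
  rewrite expRM_natr lnK ?posrE// -natrX ler_nat.
  apply: (leq_trans (_ : _ <= (d n).*2.+1)%N); first by rewrite ltnS.
  exact: double_succ_le_cube.
have lS : ln #|sym_set z|%:R <= 2 * ell n.
  have -> : 2 * ell n = ln ((d n)%:R ^+ 2) by rewrite lnXn// mulr_natl.
  rewrite ler_ln ?posrE ?exprn_gt0 ?ltr0n// -natrX ler_nat.
  by apply: (leq_trans cS); rewrite -mul2n expnS expn1 leq_mul.
have lS0 : 0 <= ln (#|sym_set z|%:R : R) by rewrite ln_ge0// ler1n.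
apply: (@mixing_ratio_dist R (X n) (sym_set z) S0 (@sym_setN _ _ z) c c0 hgap e delta r) => //.
- rewrite -/e' mulrAC ler_pdivlMr// mul1r -ler_pdivrMl//.
  apply: le_trans r1; rewrite /C2 mulrDl.
  have : 0 <= C1 / D * ell n ^+ 2 by rewrite mulr_ge0 ?sqr_ge0// divr_ge0// ltW.
  have : 2 / e' * 1 <= 2 / e' * (ell n ^+ 2 / ln 2 ^+ 2).
    by rewrite ler_wpM2l// divr_ge0// ltW.
  by rewrite -/e'; lra.
- apply: (@le_trans _ _ (expR (- (L n / 2)))); last first.
    by near: n; apply: exp_small; rewrite divr_gt0.
  apply: (@le_trans _ _ (expR (ell n * 3%:R * r%:R) / N n)).
    by rewrite ler_wpM2r ?invr_ge0// expRM_natr lerXn2r ?nnegrE ?expR_ge0.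
  rewrite -[X in _ / X](@lnK R) ?posrE// -expRN -expRD ler_expR.
  have : 6 * (C2 + (ln 2 ^+ 2)^-1) * ell n ^+ 3 <= L n by near: n; exact: cube_small.
  have : ell n * 3 * r%:R <= 3 * (C2 + (ln 2 ^+ 2)^-1) * ell n ^+ 3.
    apply: (@le_trans _ _ (ell n * 3 * (C2 * ell n ^+ 2 + ell n ^+ 2 / ln 2 ^+ 2))).
      by rewrite ler_wpM2l ?mulr_ge0 ?(ltW (ell0 n))//; lra.
    by rewrite le_eqVlt; apply/orP; left; apply/eqP; ring.
  lra.
- rewrite -/e'; apply: (@le_trans _ _ (C1 * ell n ^+ 2)); last first.
    have -> : 4 * delta ^+ 2 * c ^+ 2 * (e' / 2 * r%:R) = D * r%:R by rewrite /D; ring.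
    rewrite -ler_pdivrMl//; apply: le_trans r1; rewrite mulrA ler_wpM2r ?sqr_ge0//.
    by rewrite /C2 mulrC lerDl divr_ge0 ?(ltW l20)// divr_ge0// ltW.
  rewrite /C1 [leRHS]mulrDl; apply: lerD.
    rewrite [leRHS]mulrAC ler_wpM2r ?invr_ge0 ?(ltW e'0)// -[leRHS]mulrA ler_wpM2l//.
    have : ln #|sym_set z|%:R ^+ 2 <= (2 * ell n) ^+ 2 :> R.
      by rewrite lerXn2r ?nnegrE// mulr_ge0// ltW.
    rewrite exprMn => hh; have : 20 * 1 <= 20 * (ell n ^+ 2 / ln 2 ^+ 2) by rewrite ler_wpM2l.
    lra.
  by rewrite -[leRHS]mulrA [(ln 2 ^+ 2)^-1 * _]mulrC ler_peMr// divr_ge0 ?exprn_ge0// ltW.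
Unshelve. all: by end_near. Qed.

End Asymptotics.

Theorem corollary4 (R : realType) (a : R) (ha : 1 < a)
    (X : nat -> finZmodType) (d : nat -> nat)
    (hX : forall n, (3 <= #|X n|)%N)
    (hd0 : forall n, (0 < d n)%N)
    (hd : forall n, a * (ln #|X n|%:R / ln 2) <= (d n)%:R)
    (hlog : ln (d n)%:R / (ln #|X n|%:R `^ 3^-1) @[n --> \oo] --> (0 : R)) :
  (iid_prob R (fun z : {ffun 'I_(d n) -> X n} => generates (sym_set z))
     @[n --> \oo] --> (1 : R)) /\
  (forall e : R, 0 < e -> e < 1 ->
   forall delta : R, 0 < delta ->
     iid_prob R (fun z : {ffun 'I_(d n) -> X n} =>
       generates (sym_set z) /\
       delta < `|mixing_time (sym_set z) (1 - e) / mixing_time (sym_set z) e - 1|)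
     @[n --> \oo] --> (0 : R)).
Proof.
have [[s c] /= [s01 c0 hgap]] := random_gap ha.
have bad n := hgap (X n) (d n) (hd0 n) (hd n).
have bad0 := bad_event_small ha hX hd0 hd hlog s01.
have gen n (z : {ffun 'I_(d n) -> X n}) : has_gap c (sym_set z) -> generates (sym_set z).
  exact: (gap_generates (sym_set_gt0 z (hd0 n)) c0).
split.
  have lo : 1 - (s ^+ d n + (d n)%:R ^+ 2 / #|X n|%:R) @[n --> \oo] --> (1 : R).
    by rewrite -[X in _ --> X]subr0; apply: cvgB; [exact: cvg_cst|exact: bad0].
  apply: (squeeze_cvgr _ lo (cvg_cst _)); near=> n.
  rewrite iid_prob_le1 andbT lerBlDr.
  apply: (@le_trans _ _ (iid_prob R (fun _ : {ffun 'I_(d n) -> X n} => True))).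
    by rewrite iid_prob_total.
  apply: (le_trans (@iid_prob_union _ _ _ _ (fun z => generates (sym_set z))
    (fun z => ~ has_gap c (sym_set z)) _)).
    by move=> z _; have [/gen|] := pselect (has_gap c (sym_set z)); [left|right].
  by rewrite lerD2l bad.
move=> e e0 e1 delta delta0.
(* For large n every sample with the gap has ratio within [delta] of 1, so the event is contained in
   the failure of the gap. *)
apply: (squeeze_cvgr _ (cvg_cst 0) bad0); near=> n.
rewrite iid_prob_ge0 /=; apply: le_trans (bad n); apply: iid_prob_mono => z [_ hz] zgap.
move: hz; apply/negP; rewrite -leNgt.
move: z zgap; near: n.
exact: (ratio_close_of_gap ha hX hd0 hd hlog).
Unshelve. all: by end_near. Qed.
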